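(* Let $d$ be a non-zero natural number. The algebra of invariants $\mathbb{C}[V\times V^*]^W$ admits the following presentation. Generators: $q,r,Q,R,\mathbf{eu}_0,\mathbf{a}_{1,0},\mathbf{a}_{2,0},\dots,\mathbf{a}_{d-1,0}$. Relations: for $1\le i\le d-1$, $$(Z_i^0)\qquad \mathbf{eu}_0\,\mathbf{a}_{i,0}=q\,\mathbf{a}_{i+1,0}+Q\,\mathbf{a}_{i-1,0},$$ and for $1\le i\le j\le d-1$, $$(Z_{i,j}^0)\qquad \mathbf{a}_{i,0}\,\mathbf{a}_{j,0}=q^{d-j}Q^i\,\mathbf{eu}_0^{(j-i)}+\begin{cases} r\,\mathbf{a}_{i+j,0}-q^{d-i-j}\,\mathbf{eu}_0^{(i+j)} & \text{if } 2\le i+j\le d,\\ rR-\mathbf{eu}_0^{(d)} & \text{if } i+j=d,\\ R\,\mathbf{a}_{i+j-d,0}-Q^{i+j-d}\,\mathbf{eu}_0^{(2d-i-j)} & \text{if } d\le i+j\le 2d-2,\end{cases}$$ where $\mathbf{a}_{0,0}=r$, $\mathbf{a}_{d,0}=R$, and each $\mathbf{eu}_0^{(k)}$ is read as the polynomial in $\mathbf{eu}_0$ and $qQ$ specified in the context. (The cases overlap consistently when $i+j=d$.) This presentation is minimal, both for the number of generators and for the number of relations (there are $d+4$ generators and $(d+2)(d-1)/2$ relations). Moreover, with $P_\bullet=\mathbb{C}[V]^W\otimes\mathbb{C}[V^*]^W=\mathbb{C}[q,r,Q,R]$, $$\mathbb{C}[V\times V^*]^W=P_\bullet\oplus P_\bullet\,\mathbf{eu}_0\oplus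 P_\bullet\,\mathbf{eu}_0^2\oplus\cdots\oplus P_\bullet\,\mathbf{eu}_0^d\oplus P_\bullet\,\mathbf{a}_{1,0}\oplus P_\bullet\,\mathbf{a}_{2,0}\oplus\cdots\oplus P_\bullet\,\mathbf{a}_{d-1,0}.$$
   Context: Let $\zeta\in\mathbb{C}$ be a primitive $d$-th root of unity. $V=\mathbb{C}^2$ has canonical basis $(x,y)$ and $V^*$ has dual basis $(X,Y)$; thus $\mathbb{C}[V]=\mathbb{C}[X,Y]$, $\mathbb{C}[V^*]=\mathbb{C}[x,y]$, $\mathbb{C}[V\times V^*]=\mathbb{C}[x,y,X,Y]$. For $i\in\mathbb{Z}/d\mathbb{Z}$ let $s_i=\begin{pmatrix}0&\zeta^i\\ \zeta^{-i}&0\end{pmatrix}$ and let $W=\langle s_0,s_1\rangle\subset \mathrm{GL}_2(\mathbb{C})$, a dihedral group of order $2d$, acting on $V$ and (contragrediently) on $V^*$. Set $q=xy$, $r=x^d+y^d$, $Q=XY$, $R=X^d+Y^d$, $\mathbf{eu}_0=xX+yY$, $\mathbf{a}_{i,0}=x^{d-i}Y^i+y^{d-i}X^i$ for $0\le i\le d$, and $\mathbf{eu}_0^{(i)}=(xX)^i+(yY)^i$ for $i\ge 0$. Since $(xX)(yY)=qQ$, $\mathbf{eu}_0^{(i)}$ is a polynomial in $\mathbf{eu}_0$ and $qQ$ with integer coefficients, determined by $\mathbf{eu}_0^{(0)}=2$, $\mathbf{eu}_0^{(1)}=\mathbf{eu}_0$, $\mathbf{eu}_0^{(i+1)}=\mathbf{eu}_0\,\mathbf{eu}_0^{(i)}-qQ\,\mathbf{eu}_0^{(i-1)}$.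 Minimality means: no generating set of the $\mathbb{C}$-algebra has fewer than $d+4$ elements, and the ideal of relations among the given generators cannot be generated by fewer than $(d+2)(d-1)/2$ elements.
   Formalization: The claim that the listed relations generate all relations is made only for d ≥ 2: for d = 1 the list is empty, yet eu_0(rR − eu_0) = Q(r² − 2q) + q(R² − 2Q) holds, so the presentation as stated fails there. *)

(* Defs.v *)
From mathcomp Require Import all_boot all_order all_algebra.
From mathcomp Require Import complex mpoly.
From mathcomp Require Import reals.
From mathcomp Require Import ring.

Set Implicit Arguments.
Unset Strict Implicit.
Unset Printing Implicit Defensive.

Import GRing.Theory.

Local Open Scope ring_scope.

Definition subalgebra_gen (C : fieldType) (k n : nat)
    (s : n.-tuple {mpoly C[k]}) (f : {mpoly C[k]}) : Prop :=
  exists p : {mpoly C[n]}, f = p \mPo s.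

Definition ideal_gen (A : comNzRingType) (s : seq A) (f : A) : Prop :=
  exists c : 'I_(size s) -> A, f = \sum_i c i * s`_i.

Definition internal_direct_sum (V : zmodType) (n : nat)
    (M : V -> Prop) (N : 'I_n -> V -> Prop) : Prop :=
  (forall v, M v <->
     exists u : 'I_n -> V, (forall i, N i (u i)) /\ v = \sum_i u i)
  /\ (forall u : 'I_n -> V, (forall i, N i (u i)) ->
        \sum_i u i = 0 -> forall i, u i = 0).

(* Matrices act on column vectors; d is determined by zeta, its order. *)
Definition s_ (C : fieldType) (zeta : C) (i : nat) : 'M[C]_2 :=
  \matrix_(a, b) if (a == 0) && (b == 1) then zeta ^+ i
                 else if (a == 1) && (b == 0) then zeta ^- i else 0.

Inductive in_W (C : fieldType) (zeta : C) : 'M[C]_2 -> Prop :=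
| in_W_s0 : in_W zeta (s_ zeta 0)
| in_W_s1 : in_W zeta (s_ zeta 1)
| in_W_one : in_W zeta 1%:M
| in_W_mul w1 w2 : in_W zeta w1 -> in_W zeta w2 -> in_W zeta (w1 *m w2)
| in_W_inv w : in_W zeta w -> in_W zeta (invmx w).

(* C[V x V^*] is {mpoly C[2 + 2]}: the first two variables are the basis
   (x, y) of V (functions on V^* ), the last two the dual basis (X, Y). *)

Definition vx (C : fieldType) : {mpoly C[2 + 2]} := 'X_(lshift 2 ord0).
Definition vy (C : fieldType) : {mpoly C[2 + 2]} := 'X_(lshift 2 ord_max).
Definition vX (C : fieldType) : {mpoly C[2 + 2]} := 'X_(rshift 2 ord0).
Definition vY (C : fieldType) : {mpoly C[2 + 2]} := 'X_(rshift 2 ord_max).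

(* The algebra automorphism of Sym(V (+) V^* ) induced by w: a basis vector e_j
   of V goes to w e_j, and a dual basis vector e_j^* goes to e_j^* o w^-1. *)
Definition act (C : fieldType) (w : 'M[C]_2) (f : {mpoly C[2 + 2]})
    : {mpoly C[2 + 2]} :=
  f \mPo [tuple match split k with
                | inl j => \sum_(i < 2) w i j *: 'X_(lshift 2 i)
                | inr j => \sum_(i < 2) (invmx w) j i *: 'X_(rshift 2 i)
                end | k < 2 + 2].

Definition W_invariant (C : fieldType) (zeta : C) (f : {mpoly C[2 + 2]})
    : Prop :=
  forall w, in_W zeta w -> act w f = f.

(* C[V]^W (x) C[V^*]^W, realized inside C[V x V^*] as the set of finite sums of
   products; C[V] = C[X, Y] and C[V^*] = C[x, y]. *)
Definition P_bullet (C : fieldType) (zeta : C) (f : {mpoly C[2 + 2]}) : Prop :=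
  exists (n : nat) (g h : 'I_n -> {mpoly C[2 + 2]}),
    (forall i, subalgebra_gen [tuple vX C; vY C] (g i)
               /\ W_invariant zeta (g i)) /\
    (forall i, subalgebra_gen [tuple vx C; vy C] (h i)
               /\ W_invariant zeta (h i)) /\
    f = \sum_i g i * h i.

Definition inv_q (C : fieldType) : {mpoly C[2 + 2]} := vx C * vy C.
Definition inv_r (C : fieldType) (d : nat) : {mpoly C[2 + 2]} :=
  vx C ^+ d + vy C ^+ d.
Definition inv_Q (C : fieldType) : {mpoly C[2 + 2]} := vX C * vY C.
Definition inv_R (C : fieldType) (d : nat) : {mpoly C[2 + 2]} :=
  vX C ^+ d + vY C ^+ d.
Definition inv_eu (C : fieldType) : {mpoly C[2 + 2]} :=
  vx C * vX C + vy C * vY C.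
Definition inv_a (C : fieldType) (d i : nat) : {mpoly C[2 + 2]} :=
  vx C ^+ (d - i) * vY C ^+ i + vy C ^+ (d - i) * vX C ^+ i.

Definition gens_seq (C : fieldType) (d : nat) : seq {mpoly C[2 + 2]} :=
  [:: inv_q C; inv_r C d; inv_Q C; inv_R C d; inv_eu C]
  ++ [seq inv_a C d i | i <- index_iota 1 d].

(* gens_seq has size d + 4 when d > 0, so nothing is padded or lost. *)
Definition gens (C : fieldType) (d : nat) : (d.+4).-tuple {mpoly C[2 + 2]} :=
  [tuple (gens_seq C d)`_k | k < d.+4].

(* eu_0^(k), as a polynomial in e = eu_0 and m = qQ. *)
Fixpoint eu_pow (A : comNzRingType) (e m : A) (k : nat) : A :=
  match k with
  | 0 => 2%:R
  | k1.+1 => match k1 with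
             | 0 => e
             | k2.+1 => e * eu_pow e m k1 - m * eu_pow e m k2
             end
  end.

Lemma eu_powE (A : comNzRingType) (u v : A) (k : nat) :
  eu_pow (u + v) (u * v) k = u ^+ k + v ^+ k.
Proof.
suff [] : eu_pow (u + v) (u * v) k = u ^+ k + v ^+ k /\
  eu_pow (u + v) (u * v) k.+1 = u ^+ k.+1 + v ^+ k.+1 by [].
elim: k => [|k [IH1 IH2]]; first by rewrite /= !expr0 !expr1.
split=> //.
change (eu_pow (u + v) (u * v) k.+2) with
  ((u + v) * eu_pow (u + v) (u * v) k.+1 - u * v * eu_pow (u + v) (u * v) k).
by rewrite IH1 IH2 !exprS; ring.
Qed.

(* Indeterminates for the generators, numbered as in gens_seq; those of a_0 and
   a_d are by convention the ones of r and R. *)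

Definition var_q (C : fieldType) (d : nat) : {mpoly C[d.+4]} := 'X_(inord 0).
Definition var_r (C : fieldType) (d : nat) : {mpoly C[d.+4]} := 'X_(inord 1).
Definition var_Q (C : fieldType) (d : nat) : {mpoly C[d.+4]} := 'X_(inord 2).
Definition var_R (C : fieldType) (d : nat) : {mpoly C[d.+4]} := 'X_(inord 3).
Definition var_eu (C : fieldType) (d : nat) : {mpoly C[d.+4]} := 'X_(inord 4).
Definition var_a (C : fieldType) (d i : nat) : {mpoly C[d.+4]} :=
  if i == 0%N then var_r C d
  else if i == d then var_R C d
  else 'X_(inord (4 + i)).

Definition var_eu_pow (C : fieldType) (d k : nat) : {mpoly C[d.+4]} :=
  eu_pow (var_eu C d) (var_q C d * var_Q C d) k.

Definition rel_Z (C : fieldType) (d i : nat) : {mpoly C[d.+4]} :=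
  var_eu C d * var_a C d i
  - (var_q C d * var_a C d i.+1 + var_Q C d * var_a C d i.-1).

Definition rel_ZZ (C : fieldType) (d i j : nat) : {mpoly C[d.+4]} :=
  var_a C d i * var_a C d j
  - (var_q C d ^+ (d - j) * var_Q C d ^+ i * var_eu_pow C d (j - i)
     + if (i + j < d)%N then
         var_r C d * var_a C d (i + j)
         - var_q C d ^+ (d - i - j) * var_eu_pow C d (i + j)
       else if (i + j == d)%N then
         var_r C d * var_R C d - var_eu_pow C d d
       else
         var_R C d * var_a C d (i + j - d)
         - var_Q C d ^+ (i + j - d) * var_eu_pow C d (2 * d - i - j)).

(* For d = 1 this list is empty, although the five generators then satisfy
   eu_0 (r R - eu_0) = Q (r^2 - 2 q) + q (R^2 - 2 Q): these relations generate
   the ideal of all relations only when d > 1. *)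
Definition relations (C : fieldType) (d : nat) : seq {mpoly C[d.+4]} :=
  [seq rel_Z C d i | i <- index_iota 1 d]
  ++ [seq rel_ZZ C d i j | i <- index_iota 1 d, j <- index_iota i d].

Definition module_basis (C : fieldType) (d : nat) : seq {mpoly C[2 + 2]} :=
  [seq inv_eu C ^+ k | k <- index_iota 0 d.+1]
  ++ [seq inv_a C d i | i <- index_iota 1 d].

(* Main.v *)
(* Multiplying generators and using the relations, every polynomial in the
   generators is congruent to a combination, with coefficients in q, r, Q, R, of
   eu^0, ..., eu^d, a_1, ..., a_(d-1); the power eu^(d+1) is reduced by expanding
   eu * a_1 * a_(d-1) in two ways.  These 2d elements are independent over
   C[q, r, Q, R]: fixing (x, y) and moving (X, Y) in its W-orbit, which leaves
   q, r, Q, R unchanged, turns a linear relation into 2d equations that are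
   solved explicitly when x^d != y^d and X^d != Y^d.  Hence the relations
   generate the whole kernel.  That the generators generate is proved by
   induction on the degree of the orbit sums of monomials.  Finally the kernel
   lies in the square of the irrelevant ideal m, which gives the minimality of
   the generators, and the terms eu * a_i and a_i * a_j make the relations
   independent modulo m times the kernel. *)

Require Import Defs.
From mathcomp Require Import all_boot all_order all_algebra.
From mathcomp Require Import complex mpoly.
From mathcomp Require Import reals.
From mathcomp Require Import ring zify.

Set Implicit Arguments.
Unset Strict Implicit.
Unset Printing Implicit Defensive.

Import GRing.Theory Num.Theory.

Local Open Scope ring_scope.

(** * Polynomials vanishing everywhere *)

(** Two bases of the same span are in play. Powers of eu suit the reduction, because multiplication
    by eu only shifts them. Independence is tested instead on [(xX)^k + (yY)^k]: rotating [(X, Y)]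
    by a root of unity [u] multiplies the two summands by [u^k] and [u^-k], so a relation becomes a
    polynomial in [u]. The orbit used is that of W acting on [(X, Y)] alone, under which eu and the
    a_i are not invariant. The linear algebra happens at points, whereas the coefficients are
    polynomials in q, r, Q, R. The passage back requires every point of C^4 to be a value of
    [(q, r, Q, R)], which algebraic closedness gives, and the degenerate points are absorbed by the
    discriminants [r^2 - 4 q^d] and [R^2 - 4 Q^d]. For [d = 1] there is no a_1, so a quadratic
    equation for eu replaces the double expansion; it also lies in the square of the irrelevant
    ideal, and the minimality of the generators is therefore proved uniformly in [d]. *)

(** Makes [muni] injective: the induction on the number of variables in [meval_eq0] shows
    [muni p = 0] and needs [p = 0]. *)
Lemma coef_muni (A : comNzRingType) n (p : {mpoly A[n.+1]}) (m : 'X_{1..n.+1}) :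
  (muni p)`_(m ord_max)@_[multinom m (widen_ord (leqnSn n) i) | i < n] = p@_m.
Proof.
rewrite muniE coef_sum raddf_sum /= [in RHS](mpolyE p) raddf_sum /=.
apply: eq_bigr => k _; rewrite coefZ coefXn mulr_natr mcoeffMn !mcoeffZ.
rewrite !mcoeffX -mulrnAr; congr (_ * _); rewrite -mulrnA mulnb; congr (_%:R).
congr nat_of_bool; apply/idP/idP => [/andP[/eqP e1 /eqP e2]|/eqP <-]; last first.
  by rewrite !eqxx.
apply/eqP/mnmP => i; case: (unliftP ord_max i) => [j ->|->]; last by rewrite e2.
have -> : lift ord_max j = widen_ord (leqnSn n) j.
  by apply: val_inj; rewrite /= /bump leqNgt ltn_ord.
by have := congr1 (fun m' => fun_of_multinom m' j) e1; rewrite !mnmE.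
Qed.

Lemma horner_muni (C : comNzRingType) n (p : {mpoly C[n.+1]}) (v : 'I_n.+1 -> C) :
  p.@[v] = (map_poly (meval (fun i => v (widen_ord (leqnSn n) i))) (muni p)).[v ord_max].
Proof.
rewrite muniE mevalE raddf_sum /= horner_sum; apply: eq_bigr => m _.
rewrite big_ord_recr /= -mul_polyC rmorphM /= map_polyC /= map_polyXn.
rewrite hornerM hornerC hornerXn mevalZ mevalX mulrA; congr (_ * _ * _).
by apply: eq_bigr => i _; rewrite mnmE.
Qed.

Lemma meval_eq0 (C : numFieldType) n (p : {mpoly C[n]}) :
  (forall v, p.@[v] = 0) -> p = 0.
Proof.
elim: n p => [|n IH] p hp.
  have m0 (k : 'X_{1..0}) : k = 0%MM by apply/mnmP => -[].
  apply/mpolyP => m; rewrite (m0 m).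
  rewrite mcoeff0; have := hp (fun=> 0); rewrite mevalE => <-.
  rewrite [in LHS](mpolyE p) raddf_sum /=; apply: eq_bigr => k _.
  by rewrite mcoeffZ big_ord0 mcoeffX (m0 k) eqxx.
suff h : muni p = 0 by apply/mpolyP => m; rewrite -coef_muni h coef0 !mcoeff0.
apply/polyP => j; rewrite coef0; apply: IH => v.
rewrite -[LHS](coef_map (meval v)) /=; set P := map_poly _ _.
suff -> : P = 0 by rewrite coef0.
apply/eqP/negPn/negP => P0.
(* The integers 0, 1, 2, ... are distinct in characteristic zero; [size P] of them are one root too
   many for a nonzero [P]. *)
pose rs : seq C := [seq i%:R | i <- iota 0 (size P)].
have hu : uniq rs.
  by rewrite map_inj_uniq ?iota_uniq //; apply: mulrIn; rewrite oner_eq0.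
suff hr : all (root P) rs.
  by have := max_poly_roots P0 hr hu; rewrite size_map size_iota ltnn.
apply/allP => _ /mapP[i _ ->]; apply/rootP.
pose w (k : 'I_n.+1) := if unlift ord_max k is Some k' then v k' else i%:R.
rewrite -(hp w) horner_muni /w unlift_none; congr (_.[_]).
apply: eq_map_poly => f; apply: meval_eq => k.
have -> : widen_ord (leqnSn n) k = lift ord_max k.
  by apply: val_inj; rewrite /= /bump leqNgt ltn_ord.
by rewrite liftK.
Qed.

(** * Independence of the powers of eu and of the a_i *)

(** [x^d] and [y^d] must be the two roots [al], [be] of [t^2 - r t + q^d]. With [x] a d-th root of
    [al], [y] is [q / x]; if [al = 0], then [q = 0] and [y] is a d-th root of [be]. *)
Lemma exists_xy_of_qr (C : numClosedFieldType) d (q r : C) : (0 < d)%N ->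
  exists x y : C, x * y = q /\ x ^+ d + y ^+ d = r.
Proof.
move=> hd; pose s := sqrtC (r ^+ 2 - 4 * q ^+ d).
have hs : s ^+ 2 = r ^+ 2 - 4 * q ^+ d by rewrite sqrtCK.
pose al := (r + s) / 2; pose be := (r - s) / 2.
have two : (2 : C) != 0 by rewrite pnatr_eq0.
have hab : al * be = q ^+ d.
  apply: (mulfI (x := 4)); first by rewrite pnatr_eq0.
  by rewrite -[RHS](subKr (r ^+ 2)) -hs /al /be; field.
have hsum : al + be = r by rewrite /al /be; field.
case: (eqVneq al 0) => [al0|al0].
  exists 0, (d.-root be); rewrite mul0r rootCK // expr0n gtn_eqF //= add0r.
  split; last by rewrite -hsum al0 add0r.
  by apply/esym/eqP; move/eqP: hab; rewrite al0 mul0r eq_sym expf_eq0 hd.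
have x0 : d.-root al != 0 by rewrite rootC_eq0.
exists (d.-root al), (q / d.-root al); split; first by rewrite mulrC divfK.
by rewrite expr_div_n rootCK // -hab mulrAC mulfV // mul1r.
Qed.

Lemma eu_powSS (A : comNzRingType) (e m : A) k :
  eu_pow e m k.+2 = e * eu_pow e m k.+1 - m * eu_pow e m k.
Proof. by []. Qed.

Lemma nat_ind2 (P : nat -> Prop) :
  P 0 -> P 1 -> (forall k, P k -> P k.+1 -> P k.+2) -> forall k, P k.
Proof.
move=> h0 h1 hS k; suff [] : P k /\ P k.+1 by [].
by elim: k => [//|k [IH1 IH2]]; split => //; exact: hS.
Qed.

Lemma rmorph_eu_pow (A B : comNzRingType) (f : {rmorphism A -> B}) e m k :
  f (eu_pow e m k) = eu_pow (f e) (f m) k.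
Proof.
elim/nat_ind2: k => [||k IH1 IH2] //; first by rewrite /= rmorph_nat.
by rewrite !eu_powSS rmorphB !rmorphM IH1 IH2.
Qed.

(** Triangularity with respect to the powers of eu. The leading coefficient is 1 for [k > 0], but it
    is 2 for [k = 0], where characteristic zero enters. *)
Lemma size_eu_pow (F : numFieldType) (m : F) k :
  (size (eu_pow 'X m%:P k) <= k.+1)%N /\ (eu_pow 'X m%:P k)`_k != 0.
Proof.
elim/nat_ind2: k => [||k [s1 c1] [s2 c2]].
- by rewrite /= -polyC_natr size_polyC coefC /= pnatr_eq0.
- by rewrite /= size_polyX coefX oner_eq0.
rewrite eu_powSS; split.
  apply: (leq_trans (size_polyD _ _)); rewrite geq_max size_polyN mulrC.
  apply/andP; split.
    by apply: (leq_trans (size_polyMleq _ _)); rewrite size_polyX addn2.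
  rewrite mul_polyC; apply: (leq_trans (size_scale_leq _ _)).
  by apply: leq_trans s1 _; lia.
by rewrite coefB coefXM coefCM /= (nth_default _ (_ : size _ <= k.+2)%N) ?mulr0 ?subr0 //
   (leq_trans s1) //.
Qed.

Lemma eu_pow_basis (F : numFieldType) (m : F) n (G : {poly F}) :
  (size G <= n)%N ->
  exists g : nat -> F, G = \sum_(0 <= k < n) g k *: eu_pow 'X m%:P k.
Proof.
elim: n G => [|n IH] G sG.
  by exists (fun=> 0); rewrite big_nil; apply/eqP; rewrite -size_poly_leq0.
have [sT cT] := size_eu_pow m n; set T := eu_pow 'X m%:P n in sT cT *.
have [|g hg] := IH (G - (G`_n / T`_n) *: T).
  apply/leq_sizeP => j; rewrite leq_eqVlt => /orP[/eqP <-|lt_nj].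
    by rewrite coefB coefZ divfK // subrr.
  have /leq_sizeP sT' := sT; have /leq_sizeP sG' := sG.
  by rewrite coefB coefZ (sT' j) ?(sG' j) // mulr0 subr0.
exists (fun k => if k == n then G`_n / T`_n else g k).
rewrite big_nat_recr //= eqxx -/T; apply/eqP; rewrite -subr_eq hg.
apply/eqP; apply: eq_big_nat => k /andP[_ ltkn].
by rewrite ltn_eqF.
Qed.

Section ScalarIndependence.

Variables (C : numClosedFieldType) (d : nat) (zeta : C).
Hypotheses (hd : (0 < d)%N) (hz : d.-primitive_root zeta).
Variables (x y : C) (g a : nat -> C).

(** The value of a linear relation whose coefficients in q, r, Q, R are frozen to scalars, as they
    are constant on the orbit of [(X, Y)]. *)
Let F (X Y : C) := \sum_(0 <= k < d.+1) g k * ((x * X) ^+ k + (y * Y) ^+ k)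
  + \sum_(1 <= i < d) a i * (x ^+ (d - i) * Y ^+ i + y ^+ (d - i) * X ^+ i).

(* F (u X) (Y / u) is a polynomial of degree < d in u for u ^ d = 1; it vanishes
   at the d roots of unity, so its coefficients vanish. *)
Lemma rotation_coefs (X Y : C) :
  (forall j, F (zeta ^+ j * X) (zeta ^- j * Y) = 0) ->
  g 0%N * 2 + g d * (x ^+ d * X ^+ d + y ^+ d * Y ^+ d) = 0 /\
  (forall k, (0 < k < d)%N ->
     (g k * x ^+ k + a k * y ^+ (d - k)) * X ^+ k
     + (g (d - k)%N * y ^+ (d - k) + a (d - k)%N * x ^+ k) * Y ^+ (d - k) = 0).
Proof.
move=> hF.
(* Exponents of [u] are read modulo [d]: [u^-k] becomes [u^(d-k)], so the indices [k] and [d - k]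
   share a coefficient, and the indices 0 and [d] both land in the constant one. *)
pose h k := if k == 0%N then g 0%N * 2 + g d * (x ^+ d * X ^+ d + y ^+ d * Y ^+ d)
  else (g k * x ^+ k + a k * y ^+ (d - k)) * X ^+ k
     + (g (d - k)%N * y ^+ (d - k) + a (d - k)%N * x ^+ k) * Y ^+ (d - k).
suff H0 : \poly_(k < d) h k = 0.
  have hk k : (k < d)%N -> h k = 0.
    by move=> ltkd; rewrite -[RHS](coef0 _ k) -H0 coef_poly ltkd.
  split=> [|k /andP[k0 ltkd]]; first exact: (hk 0%N).
  by have := hk k ltkd; rewrite /h gtn_eqF.
apply/eqP/negPn/negP => P0.
pose rs := [seq zeta ^+ j | j <- iota 0 d].
have hu : uniq rs.
  rewrite map_inj_in_uniq ?iota_uniq // => i j; rewrite !mem_iota /= !add0n.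
  by move=> hi hj /eqP; rewrite (eq_prim_root_expr hz) !modn_small // => /eqP.
suff hr : all (root (\poly_(k < d) h k)) rs.
  have := max_poly_roots P0 hr hu; rewrite size_map size_iota ltnNge.
  by rewrite size_poly.
apply/allP => _ /mapP[j _ ->]; apply/rootP; rewrite -[RHS](hF j) /F.
set u := zeta ^+ j.
have ud : u ^+ d = 1 by rewrite -exprM mulnC exprM (prim_expr_order hz) expr1n.
have u0 : u != 0.
  by apply: contra_eq_neq ud => ->; rewrite expr0n gtn_eqF // eq_sym oner_eq0.
have uV k : (k <= d)%N -> u^-1 ^+ k = u ^+ (d - k).
  move=> lekd; apply: (mulIf (expf_neq0 k u0)).
  by rewrite -exprD subnK // ud -exprMn mulVf // expr1n.
rewrite horner_poly -(big_mkord xpredT (fun k => h k * u ^+ k)) big_ltn //.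
rewrite [in RHS]big_nat_recr //= [in RHS]big_ltn // !expr0 mulr1 /h eqxx.
pose G k := (g k * y ^+ k + a k * x ^+ (d - k)) * Y ^+ k * u ^+ (d - k).
transitivity (g 0%N * 2 + g d * (x ^+ d * X ^+ d + y ^+ d * Y ^+ d)
  + (\sum_(1 <= k < d) (g k * x ^+ k + a k * y ^+ (d - k)) * X ^+ k * u ^+ k
    + \sum_(1 <= k < d) G k)).
  congr (_ + _); rewrite [X in _ = _ + X]big_nat_rev -big_split /=.
  apply: eq_big_nat => k /andP[k0 ltkd]; rewrite gtn_eqF // /G.
  by rewrite add1n subSS subKn ?(ltnW ltkd) // mulrDl.
have -> : (x * (u * X)) ^+ d + (y * (u^-1 * Y)) ^+ d = x ^+ d * X ^+ d + y ^+ d * Y ^+ d.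
  by rewrite !exprMn ud uV // subnn expr0 !mul1r.
set D := x ^+ d * _ + _; set T1 := (X in _ = _ + X + _ + _).
set T2 := (X in _ = _ + _ + _ + X).
suff -> : \sum_(1 <= k < d) (g k * x ^+ k + a k * y ^+ (d - k)) * X ^+ k * u ^+ k
    + \sum_(1 <= k < d) G k = T1 + T2 by ring.
rewrite -!big_split /=; apply: eq_big_nat => k /andP[k0 ltkd].
rewrite /G -(uV k) ?(ltnW ltkd) // !exprMn; ring.
Qed.

(** Two nested 2 by 2 systems. The orbits of [(X, Y)] and [(Y, X)] give equations in [A] and [B]
    with determinant [X^d - Y^d]. Then [A = 0] at [k] and [B = 0] at [d - k] are equations in [g k]
    and [a k] with determinant [x^d - y^d]. The constant coefficients of the two orbits, subtracted,
    isolate [g d]. *)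
Lemma scalar_independence (X Y : C) :
  x ^+ d != y ^+ d -> X ^+ d != Y ^+ d ->
  (forall j, F (zeta ^+ j * X) (zeta ^- j * Y) = 0) ->
  (forall j, F (zeta ^+ j * Y) (zeta ^- j * X) = 0) ->
  (forall k, (k <= d)%N -> g k = 0) /\ (forall i, (0 < i < d)%N -> a i = 0).
Proof.
move=> hxy hXY /rotation_coefs [e0 ek] /rotation_coefs [e0' ek'].
have AB k : (0 < k < d)%N -> g k * x ^+ k + a k * y ^+ (d - k) = 0 /\
    g (d - k)%N * y ^+ (d - k) + a (d - k)%N * x ^+ k = 0.
  move=> hk; have hkd : (k <= d)%N by case/andP: hk => _ /ltnW.
  have := ek k hk; have := ek' k hk; set A := _ + _ * y ^+ _; set B := _ + _ * x ^+ k.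
  move=> e2 e1.
  have XE : X ^+ d = X ^+ k * X ^+ (d - k) by rewrite -exprD subnKC.
  have YE : Y ^+ d = Y ^+ k * Y ^+ (d - k) by rewrite -exprD subnKC.
  have hA : A * (X ^+ d - Y ^+ d) = 0.
    have -> : A * (X ^+ d - Y ^+ d) = (A * X ^+ k + B * Y ^+ (d - k)) * X ^+ (d - k)
      - (A * Y ^+ k + B * X ^+ (d - k)) * Y ^+ (d - k) by rewrite XE YE; ring.
    by rewrite e1 e2 !mul0r subrr.
  have hB : B * (X ^+ d - Y ^+ d) = 0.
    have -> : B * (X ^+ d - Y ^+ d) = (A * Y ^+ k + B * X ^+ (d - k)) * X ^+ k
      - (A * X ^+ k + B * Y ^+ (d - k)) * Y ^+ k by rewrite XE YE; ring.
    by rewrite e1 e2 !mul0r subrr.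
  by split; apply: (mulIf (x := X ^+ d - Y ^+ d)); rewrite ?subr_eq0 // mul0r.
have gak k : (0 < k < d)%N -> g k = 0 /\ a k = 0.
  move=> hk; have hkd : (k <= d)%N by case/andP: hk => _ /ltnW.
  have [e1 _] := AB k hk; have [|_] := AB (d - k)%N; first lia.
  rewrite subKn // => e2.
  have XE : x ^+ d = x ^+ k * x ^+ (d - k) by rewrite -exprD subnKC.
  have YE : y ^+ d = y ^+ k * y ^+ (d - k) by rewrite -exprD subnKC.
  split; apply: (mulIf (x := x ^+ d - y ^+ d)); rewrite ?subr_eq0 // mul0r XE YE.
    rewrite -[RHS](subr0 0) -{1}(mul0r (x ^+ (d - k))) -{1}e1 -(mul0r (y ^+ (d - k))) -e2.
    by ring.
  rewrite -[RHS](subr0 0) -{1}(mul0r (x ^+ k)) -{1}e2 -(mul0r (y ^+ k)) -e1.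
  by ring.
have gd : g d = 0.
  apply: (mulIf (x := (x ^+ d - y ^+ d) * (X ^+ d - Y ^+ d))).
    by rewrite mulf_neq0 // subr_eq0.
  by rewrite mul0r -[RHS](subr0 0) -{1}e0 -e0'; ring.
have g0 : g 0%N = 0.
  move: e0; rewrite gd mul0r addr0 => /eqP.
  by rewrite mulf_eq0 pnatr_eq0 orbF => /eqP.
split=> [k|k /gak[]//]; rewrite leq_eqVlt => /orP[/eqP -> //|ltkd].
by case: (posnP k) => [-> //|k0]; have [] := gak k; rewrite ?k0.
Qed.

End ScalarIndependence.

Definition pt (C : fieldType) (x y z t : C) (k : 'I_4) : C :=
  nth 0 [:: x; y; z; t] k.

Lemma pt_eta (C : fieldType) (v : 'I_4 -> C) :
  v =1 pt (v (inord 0)) (v (inord 1)) (v (inord 2)) (v (inord 3)).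
Proof.
move=> k; case: k => [[|[|[|[|k]]]] hk] //=; rewrite /pt /=; congr v;
  by apply: val_inj; rewrite /= inordK.
Qed.

Definition fund (C : fieldType) (d : nat) (x y X Y : C) : 'I_4 -> C :=
  pt (x * y) (x ^+ d + y ^+ d) (X * Y) (X ^+ d + Y ^+ d).

(** Since [r^2 - 4 q^d = (x^d - y^d)^2], multiplying [p] by both discriminants gives a polynomial
    that vanishes also at the points excluded by the hypothesis. The discriminants are nonzero,
    being 1 at [(0, 1, 0, 1)], and cancel. *)
Lemma eq0_on_fund (C : numClosedFieldType) d (p : {mpoly C[4]}) : (0 < d)%N ->
  (forall x y X Y : C, x ^+ d != y ^+ d -> X ^+ d != Y ^+ d ->
     p.@[fund d x y X Y] = 0) -> p = 0.
Proof.
move=> hd hp.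
pose disc (i j : 'I_4) : {mpoly C[4]} := 'X_j ^+ 2 - 4 *: 'X_i ^+ d.
have discE i j v : (disc i j).@[v] = v j ^+ 2 - 4 * v i ^+ d.
  by rewrite mevalB mevalZ !rmorphXn /= !mevalXU.
suff : p * (disc (inord 0) (inord 1) * disc (inord 2) (inord 3)) = 0.
  move/eqP; rewrite mulf_eq0 => /orP[/eqP //|/eqP].
  move/(congr1 (meval (pt 0 1 0 1))); rewrite mevalM !discE meval0 /pt !inordK //=.
  by rewrite expr0n gtn_eqF // mulr0 subr0 expr1n mulr1 => /eqP; rewrite oner_eq0.
apply: meval_eq0 => v; rewrite !mevalM !discE.
have [x [y [exy exyd]]] := exists_xy_of_qr (v (inord 0)) (v (inord 1)) hd.
have [X [Y [eXY eXYd]]] := exists_xy_of_qr (v (inord 2)) (v (inord 3)) hd.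
have discxy (a b : C) :
    (a ^+ d + b ^+ d) ^+ 2 - 4 * (a * b) ^+ d = (a ^+ d - b ^+ d) ^+ 2.
  by rewrite exprMn; ring.
rewrite -exy -exyd -eXY -eXYd !discxy.
case: (eqVneq (x ^+ d) (y ^+ d)) => [->|nxy].
  by rewrite subrr expr0n !(mul0r, mulr0).
case: (eqVneq (X ^+ d) (Y ^+ d)) => [->|nXY].
  by rewrite subrr expr0n !(mul0r, mulr0).
rewrite (meval_eq _ (pt_eta v)) -exy -exyd -eXY -eXYd.
by rewrite (hp x y X Y nxy nXY) mul0r.
Qed.

Lemma fund_rot (C : fieldType) d (u x y X Y : C) : u != 0 -> u ^+ d = 1 ->
  fund d x y (u * X) (u^-1 * Y) =1 fund d x y X Y.
Proof.
move=> u0 ud k; rewrite /fund !exprMn exprVn ud invr1 !mul1r.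
by rewrite mulrACA mulfV // mul1r.
Qed.

Lemma fund_swap (C : fieldType) d (x y X Y : C) :
  fund d x y Y X =1 fund d x y X Y.
Proof. by move=> k; rewrite /fund [Y * X]mulrC [Y ^+ d + _]addrC. Qed.

Lemma fund_independence (C : numClosedFieldType) d (zeta : C)
    (c a : nat -> {mpoly C[4]}) : (0 < d)%N -> d.-primitive_root zeta ->
  (forall x y X Y : C,
     \sum_(0 <= k < d.+1) (c k).@[fund d x y X Y] * (x * X + y * Y) ^+ k
     + \sum_(1 <= i < d) (a i).@[fund d x y X Y]
         * (x ^+ (d - i) * Y ^+ i + y ^+ (d - i) * X ^+ i) = 0) ->
  (forall k, (k <= d)%N -> c k = 0) /\ (forall i, (0 < i < d)%N -> a i = 0).
Proof.
move=> hd hz h.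
suff H x y X Y : x ^+ d != y ^+ d -> X ^+ d != Y ^+ d ->
    (forall k, (k <= d)%N -> (c k).@[fund d x y X Y] = 0) /\
    (forall i, (0 < i < d)%N -> (a i).@[fund d x y X Y] = 0).
  split=> [k hk|i hi]; apply: (eq0_on_fund hd) => x y X Y nxy nXY.
    by have [-> ] := H x y X Y nxy nXY.
  by have [_ ->] := H x y X Y nxy nXY.
move=> nxy nXY; set v := fund d x y X Y.
pose G := \poly_(k < d.+1) (c k).@[v].
(* The value [x y X Y] of [qQ] does not change along the orbit, so a single family [g] serves all
   its points. *)
have [g hg] := eu_pow_basis (x * y * (X * Y)) (size_poly _ _ : (size G <= d.+1)%N).
have GE u w : x * y * (X * Y) = u * w ->
    \sum_(0 <= k < d.+1) (c k).@[v] * (u + w) ^+ k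
    = \sum_(0 <= k < d.+1) g k * (u ^+ k + w ^+ k).
  move=> e; transitivity G.[u + w].
    by rewrite horner_poly big_mkord.
  rewrite hg horner_sum; apply: eq_bigr => k _; rewrite hornerZ; congr (_ * _).
  have := rmorph_eu_pow (horner_eval (u + w)) 'X (x * y * (X * Y))%:P k.
  by rewrite /= !horner_evalE hornerX hornerC {2}e eu_powE.
have uP j : zeta ^+ j != 0 /\ (zeta ^+ j) ^+ d = 1.
  have ud : (zeta ^+ j) ^+ d = 1.
    by rewrite -exprM mulnC exprM (prim_expr_order hz) expr1n.
  split=> //; apply: contra_eq_neq ud => ->.
  by rewrite expr0n gtn_eqF // eq_sym oner_eq0.
have [hc ha] : (forall k, (k <= d)%N -> g k = 0)
    /\ (forall i, (0 < i < d)%N -> (a i).@[v] = 0).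
  apply: (scalar_independence hd hz nxy nXY) => j; have [u0 ud] := uP j.
    rewrite -GE; last by field.
    rewrite -[RHS](h x y (zeta ^+ j * X) (zeta ^- j * Y)).
    congr (_ + _); apply: eq_bigr => k _;
      by rewrite (meval_eq _ (fund_rot x y X Y u0 ud)).
  rewrite -GE; last by field.
  rewrite -[RHS](h x y (zeta ^+ j * Y) (zeta ^- j * X)).
  congr (_ + _); apply: eq_bigr => k _;
    by rewrite (meval_eq _ (fund_rot x y Y X u0 ud)) (meval_eq _ (fund_swap d x y X Y)).
split=> // k hk.
have G0 : G = 0.
  by rewrite hg big_nat big1 // => i /andP[_ hi]; rewrite hc ?scale0r.
by rewrite -[RHS](coef0 _ k) -G0 coef_poly ltnS hk.
Qed.

(** * Normal forms modulo an ideal containing the relations *)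

Section NormalForm.

Variables (C : numClosedFieldType) (d : nat).
Hypothesis hd : (0 < d)%N.

Local Notation A := {mpoly C[d.+4]}.
Local Notation q := (var_q C d).
Local Notation r := (var_r C d).
Local Notation Q := (var_Q C d).
Local Notation R := (var_R C d).
Local Notation e := (var_eu C d).
Local Notation T := (var_eu_pow C d).

Definition emb (c : {mpoly C[4]}) : A := c \mPo [tuple q; r; Q; R].

Definition normal_form (c a : nat -> {mpoly C[4]}) : A :=
  \sum_(0 <= k < d.+1) emb (c k) * e ^+ k
  + \sum_(1 <= i < d) emb (a i) * var_a C d i.

Variable I : A -> Prop.
Hypotheses (I0 : I 0) (IB : forall p p', I p -> I p' -> I (p - p')).
Hypothesis IM : forall c p, I p -> I (c * p).

Let ID p p' : I p -> I p' -> I (p + p').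
Proof.
by move=> h h'; rewrite -[p']opprK; apply: IB => //; rewrite -sub0r; apply: IB.
Qed.

Definition reducible (p : A) : Prop := exists c a, I (p - normal_form c a).

Lemma embM c c' : emb (c * c') = emb c * emb c'.
Proof. exact: rmorphM. Qed.

Lemma emb_var (i : 'I_4) : emb 'X_i = 'X_(inord i).
Proof. by rewrite /emb comp_mpolyXU; case: i => [[|[|[|[|i]]]] hi]. Qed.

Lemma reducible_eqmod p p' : I (p - p') -> reducible p' -> reducible p.
Proof.
move=> h [c [a h']]; exists c, a.
by have := ID h h'; rewrite addrA subrK.
Qed.

Lemma reducible0 : reducible 0.
Proof.
exists (fun=> 0), (fun=> 0); rewrite /normal_form /emb !big1 ?addr0 ?subr0 //.
  by move=> i _; rewrite comp_mpoly0 mul0r.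
by move=> i _; rewrite comp_mpoly0 mul0r.
Qed.

Lemma reducibleD p p' : reducible p -> reducible p' -> reducible (p + p').
Proof.
move=> [c [a h]] [c' [a' h']]; exists (fun k => c k + c' k), (fun k => a k + a' k).
suff -> : normal_form (fun k => c k + c' k) (fun k => a k + a' k)
    = normal_form c a + normal_form c' a'.
  by have := ID h h'; rewrite addrACA -opprD.
rewrite /normal_form addrACA -!big_split /=.
by congr (_ + _); apply: eq_bigr => k _; rewrite /emb comp_mpolyD mulrDl.
Qed.

Lemma reducible_emb b p : reducible p -> reducible (emb b * p).
Proof.
move=> [c [a h]]; exists (fun k => b * c k), (fun k => b * a k).
suff -> : normal_form (fun k => b * c k) (fun k => b * a k) = emb b * normal_form c a.
  by rewrite -mulrBr; apply: IM.
rewrite /normal_form mulrDr !mulr_sumr.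
by congr (_ + _); apply: eq_bigr => k _; rewrite embM mulrA.
Qed.

Lemma reducibleN p : reducible p -> reducible (- p).
Proof. by move/(reducible_emb (-1)); rewrite /emb rmorphN1 mulN1r. Qed.

Lemma reducibleB p p' : reducible p -> reducible p' -> reducible (p - p').
Proof. by move=> h /reducibleN; apply: reducibleD. Qed.

Lemma reducible_sum (J : Type) (s : seq J) (P : pred J) (F : J -> A) :
  (forall i, P i -> reducible (F i)) -> reducible (\sum_(i <- s | P i) F i).
Proof.
move=> h; elim/big_rec: _ => [|i p hi]; first exact: reducible0.
by apply: reducibleD; apply: h.
Qed.

Lemma reducibleZ b p : reducible p -> reducible (b *: p).
Proof. by move/(reducible_emb b%:MP); rewrite /emb comp_mpolyC mul_mpolyC. Qed.

Lemma emb_q : emb 'X_(inord 0) = q. Proof. by rewrite emb_var inordK. Qed.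
Lemma emb_r : emb 'X_(inord 1) = r. Proof. by rewrite emb_var inordK. Qed.
Lemma emb_Q : emb 'X_(inord 2) = Q. Proof. by rewrite emb_var inordK. Qed.
Lemma emb_R : emb 'X_(inord 3) = R. Proof. by rewrite emb_var inordK. Qed.

Lemma reducible_q p : reducible p -> reducible (q * p).
Proof. by rewrite -emb_q; apply: reducible_emb. Qed.
Lemma reducible_r p : reducible p -> reducible (r * p).
Proof. by rewrite -emb_r; apply: reducible_emb. Qed.
Lemma reducible_Q p : reducible p -> reducible (Q * p).
Proof. by rewrite -emb_Q; apply: reducible_emb. Qed.
Lemma reducible_R p : reducible p -> reducible (R * p).
Proof. by rewrite -emb_R; apply: reducible_emb. Qed.

Lemma reducible_qX k p : reducible p -> reducible (q ^+ k * p).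
Proof.
by move=> h; elim: k => [|k IH]; rewrite ?mul1r // exprS -mulrA; apply: reducible_q.
Qed.

Lemma reducible_QX k p : reducible p -> reducible (Q ^+ k * p).
Proof.
by move=> h; elim: k => [|k IH]; rewrite ?mul1r // exprS -mulrA; apply: reducible_Q.
Qed.

Lemma reducible_eX k : (k <= d)%N -> reducible (e ^+ k).
Proof.
move=> hk; exists (fun j => (j == k)%:R), (fun=> 0).
suff -> : normal_form (fun j => (j == k)%:R) (fun=> 0) = e ^+ k by rewrite subrr.
rewrite /normal_form [X in _ + X]big1 ?addr0; last first.
  by move=> i _; rewrite /emb comp_mpoly0 mul0r.
rewrite big_mkord (bigD1 (Ordinal (hk : (k < d.+1)%N))) //= eqxx big1 ?addr0.
  by rewrite /emb comp_mpoly1 mul1r.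
move=> i; rewrite -val_eqE /= => /negPf ->.
by rewrite /emb comp_mpoly0 mul0r.
Qed.

Lemma reducible_a i : (i <= d)%N -> reducible (var_a C d i).
Proof.
case: (posnP i) => [-> _|i0].
  by rewrite /var_a -[r]mulr1; apply/reducible_r/(@reducible_eX 0).
rewrite leq_eqVlt => /orP[/eqP ->|hi].
  rewrite /var_a gtn_eqF // eqxx -[R]mulr1; exact/reducible_R/(@reducible_eX 0).
exists (fun=> 0), (fun j => (j == i)%:R).
suff -> : normal_form (fun=> 0) (fun j => (j == i)%:R) = var_a C d i by rewrite subrr.
rewrite /normal_form [X in X + _]big1 ?add0r; last first.
  by move=> j _; rewrite /emb comp_mpoly0 mul0r.
rewrite (@big_cat_nat _ _ _ i) //= 1?ltnW // [X in _ + X]big_ltn // eqxx.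
rewrite big_nat big1 ?add0r; last first.
  by move=> j /andP[_ hj]; rewrite ltn_eqF // /emb comp_mpoly0 mul0r.
rewrite big_nat big1 ?addr0; last first.
  by move=> j /andP[hj _]; rewrite gtn_eqF // /emb comp_mpoly0 mul0r.
by rewrite /emb comp_mpoly1 mul1r.
Qed.

(** The recursion for [T] preserves [j + k] in one term and lowers it by 2 in the other, so no power
    of eu above [d] ever appears. *)
Lemma reducible_eT j k : (j + k <= d)%N -> reducible (e ^+ j * T k).
Proof.
elim/nat_ind2: k j => [|| k IH1 IH2] j hj.
- rewrite /var_eu_pow mulr_natr -scaler_nat; apply/reducibleZ/reducible_eX.
  by rewrite -(addn0 j).
- by rewrite /var_eu_pow -exprSr; apply/reducible_eX; rewrite -addn1.
rewrite /var_eu_pow eu_powSS mulrBr mulrA -exprSr; apply: reducibleB.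
  by apply: IH2; lia.
rewrite mulrCA -mulrA; apply/reducible_q/reducible_Q/IH1; lia.
Qed.

Lemma reducible_T k : (k <= d)%N -> reducible (T k).
Proof. by move=> hk; rewrite -[T k]mul1r -(expr0 e); apply: reducible_eT. Qed.

(** The leading power may be [eu^(d+1)], which is not known to be reducible at this point; only the
    remaining terms, of degree at most [j + k - 1] in eu, are. *)
Lemma reducible_eT_lead j k : (j + k <= d)%N ->
  reducible (e ^+ j * T k.+1 - e ^+ (j + k.+1)).
Proof.
elim/nat_ind2: k j => [|| k IH1 IH2] j hj.
- by rewrite addn1 /var_eu_pow -exprSr subrr; apply: reducible0.
- rewrite /var_eu_pow eu_powSS mulrBr mulrA -exprSr -[eu_pow _ _ 1]/e -exprSr.
  rewrite addn2 addrAC subrr sub0r mulrCA -mulrA.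
  apply/reducibleN/reducible_q/reducible_Q/(@reducible_eT j 0); lia.
rewrite /var_eu_pow eu_powSS mulrBr mulrA -exprSr addrAC; apply: reducibleB.
  by rewrite addnS -addSn; apply: IH2; lia.
rewrite mulrCA -mulrA; apply/reducible_q/reducible_Q/reducible_eT; lia.
Qed.

Hypothesis IZ : forall i, (0 < i < d)%N -> I (rel_Z C d i).
Hypothesis IZZ : forall i j, (0 < i)%N -> (i <= j < d)%N -> I (rel_ZZ C d i j).

Lemma reducible_aa i j : (0 < i < d)%N -> (0 < j < d)%N ->
  reducible (var_a C d i * var_a C d j).
Proof.
wlog le_ij : i j / (i <= j)%N.
  by move=> h hi hj; case/orP: (leq_total i j) => /h; [|rewrite mulrC]; apply.
move=> /andP[i0 _] /andP[_ ltjd].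
apply: (reducible_eqmod (IZZ i0 _)); first by rewrite le_ij.
apply: reducibleD.
  by rewrite -mulrA; apply/reducible_qX/reducible_QX/reducible_T; lia.
case: ltnP => hij.
  apply: reducibleB; first by apply/reducible_r/reducible_a/ltnW.
  by apply/reducible_qX/reducible_T/ltnW.
case: eqVneq => [_|nij].
  apply: reducibleB; last exact: reducible_T.
  apply/reducible_r; rewrite -[R]mulr1.
  exact/reducible_R/(@reducible_eX 0).
apply: reducibleB; first by apply/reducible_R/reducible_a; lia.
by apply/reducible_QX/reducible_T; lia.
Qed.

(* The monomial eu * a_1 * a_(d-1) can be reduced in two ways, by Z_1 and by
   Z_(1, d-1); comparing them gives a monic equation of degree d+1 for eu. *)
Lemma reducible_eu_top : (1 < d)%N -> reducible (e ^+ d.+1).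
Proof.
move=> d1.
(* Up to reducible terms [eu^(d+1)] is [e * T d], and [T d] is a term of the relation Z_(1, d-1). *)
have ->: e ^+ d.+1 = e * T d - (e ^+ 1 * T d.-1.+1 - e ^+ (1 + d.-1.+1)).
  by rewrite prednK // expr1 subKr.
apply: reducibleB; last by apply: reducible_eT_lead; rewrite add1n prednK.
pose a := var_a C d.
have h : e * T d = e * rel_ZZ C d 1 d.-1 - a d.-1 * rel_Z C d 1
    + (q * (Q * (e ^+ 1 * T d.-2)) + r * (R * e ^+ 1)
       - (q * (a 2 * a d.-1) + Q * (r * a d.-1))).
  rewrite /rel_ZZ /rel_Z -/(a 1) -/(a d.-1) -/(a 2).
  have -> : (1 + d.-1 < d)%N = false by lia.
  have -> : (1 + d.-1 == d)%N by lia.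
  have -> : (d - d.-1 = 1)%N by lia.
  have -> : (d.-1 - 1 = d.-2)%N by lia.
  by rewrite -[var_a C d 1.-1]/(var_r C d); ring.
apply: (@reducible_eqmod _ (q * (Q * (e ^+ 1 * T d.-2)) + r * (R * e ^+ 1)
       - (q * (a 2 * a d.-1) + Q * (r * a d.-1)))).
  rewrite h addrK; apply: IB; apply: IM; [apply: IZZ; lia|apply: IZ; lia].
apply: reducibleB; apply: reducibleD.
- by apply/reducible_q/reducible_Q/reducible_eT; lia.
- by apply/reducible_r/reducible_R/reducible_eX.
(* For [d = 2] the factor [a 2] is [R], a coefficient, and [reducible_aa] does not apply. *)
- apply/reducible_q; move: d1; rewrite leq_eqVlt => /orP[/eqP d2|d2].
    have -> : a 2 = R by rewrite /a /var_a -d2.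
    by apply/reducible_R/reducible_a; lia.
  by apply: reducible_aa; lia.
apply/reducible_Q/reducible_r/reducible_a; lia.
Qed.

(** Kept as a hypothesis because it has two sources: [reducible_eu_top] for [d > 1] and [rel_one]
    for [d = 1]. *)
Hypothesis top : reducible (e ^+ d.+1).

Lemma reducible_e p : reducible p -> reducible (e * p).
Proof.
move=> [c [a h]]; apply: (@reducible_eqmod _ (e * normal_form c a)).
  by rewrite -mulrBr; apply: IM.
rewrite /normal_form mulrDr !mulr_sumr; apply: reducibleD.
  rewrite big_nat; apply: reducible_sum => k /andP[_ hk].
  rewrite mulrCA -exprS; apply: reducible_emb.
  move: hk; rewrite ltnS leq_eqVlt => /orP[/eqP -> //|hk].
  exact: reducible_eX.
rewrite big_nat; apply: reducible_sum => i hi.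
rewrite mulrCA; apply: reducible_emb.
apply: (reducible_eqmod (IZ hi)); case/andP: hi => i0 hi; apply: reducibleD.
  by apply/reducible_q/reducible_a.
by apply/reducible_Q/reducible_a; lia.
Qed.

Lemma reducible_mul_a i p : (0 < i < d)%N ->
  reducible p -> reducible (var_a C d i * p).
Proof.
move=> hi [c [a h]]; apply: (@reducible_eqmod _ (var_a C d i * normal_form c a)).
  by rewrite -mulrBr; apply: IM.
rewrite /normal_form mulrDr !mulr_sumr; apply: reducibleD.
  apply: reducible_sum => k _; rewrite mulrCA; apply: reducible_emb.
  elim: k => [|k IH]; last by rewrite exprS mulrCA; apply: reducible_e.
  by rewrite mulr1; apply: reducible_a; case/andP: hi => _ /ltnW.
rewrite big_nat; apply: reducible_sum => j hj; rewrite mulrCA.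
exact/reducible_emb/reducible_aa.
Qed.

Lemma reducible_var (t : 'I_(d.+4)) p : reducible p -> reducible ('X_t * p).
Proof.
move=> h; rewrite -(inord_val t); case: t => [[|[|[|[|[|t]]]]] ht] /=.
- exact: reducible_q.
- exact: reducible_r.
- exact: reducible_Q.
- exact: reducible_R.
- exact: reducible_e.
have -> : 'X_(inord t.+4.+1) = var_a C d t.+1.
  by rewrite /var_a /= ltn_eqF //; lia.
by apply: reducible_mul_a => //; lia.
Qed.

(** Reducible elements contain 1 and are stable under every variable. The induction over a monomial
    carries a reducible factor [s], since stability under products is only known one variable at a
    time. *)
Lemma reducible_all p : reducible p.
Proof.
elim/mpolyind: p => [|c m p _ _]; first exact: reducible0.
apply/reducibleD/reducibleZ; rewrite -['X_[m]]mulr1 mpolyXE_id.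
apply: (big_ind (fun f => forall s, reducible s -> reducible (f * s))).
- by move=> s; rewrite mul1r.
- by move=> f f' hf hf' s hs; rewrite -mulrA; apply/hf/hf'.
- move=> i _ s hs; elim: (m i) => [|k IH]; first by rewrite mul1r.
  by rewrite exprS -mulrA; apply: reducible_var.
exact: (@reducible_eX 0).
Qed.

End NormalForm.

Lemma comp_mpolyA (A : comNzRingType) k l n (p : {mpoly A[k]})
    (s : k.-tuple {mpoly A[l]}) (t : l.-tuple {mpoly A[n]}) :
  (p \mPo s) \mPo t = p \mPo [tuple tnth s i \mPo t | i < k].
Proof.
rewrite (comp_mpolyE p s) (comp_mpolyE p) raddf_sum /=.
apply: eq_bigr => m _; rewrite comp_mpolyZ rmorph_prod; congr (_ *: _).
by apply: eq_bigr => i _; rewrite rmorphXn tnth_mktuple.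
Qed.

(** * The ideal of relations *)

Section Ideals.

Variables (A : comNzRingType) (s : seq A).

Lemma ideal_gen0 : ideal_gen s 0.
Proof. by exists (fun=> 0); rewrite big1 // => i _; rewrite mul0r. Qed.

Lemma ideal_genB f g : ideal_gen s f -> ideal_gen s g -> ideal_gen s (f - g).
Proof.
move=> [c ->] [c' ->]; exists (fun i => c i - c' i); rewrite -sumrB.
by apply: eq_bigr => i _; rewrite mulrBl.
Qed.

Lemma ideal_genM g f : ideal_gen s f -> ideal_gen s (g * f).
Proof.
move=> [c ->]; exists (fun i => g * c i); rewrite mulr_sumr.
by apply: eq_bigr => i _; rewrite mulrA.
Qed.

Lemma ideal_gen_mem f : f \in s -> ideal_gen s f.
Proof.
rewrite -index_mem => hf; exists (fun i => (i == Ordinal hf)%:R).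
rewrite (bigD1 (Ordinal hf)) //= eqxx mul1r nth_index -?index_mem // big1 ?addr0 //.
by move=> i /negPf ->; rewrite mul0r.
Qed.

Lemma ideal_gen_ind (P : A -> Prop) :
  P 0 -> (forall f g, P f -> P g -> P (f + g)) -> (forall g f, P f -> P (g * f)) ->
  (forall f, f \in s -> P f) -> forall f, ideal_gen s f -> P f.
Proof.
move=> P0 PD PM Ps f [c ->]; apply: (big_ind P) => // i _.
by apply/PM/Ps/mem_nth.
Qed.

End Ideals.

(** * Evaluation at the generators and its kernel *)

Section Presentation.

Variables (C : numClosedFieldType) (d : nat).
Hypothesis hd : (0 < d)%N.

Local Notation x := (vx C).
Local Notation y := (vy C).
Local Notation X := (vX C).
Local Notation Y := (vY C).
Local Notation ev p := (p \mPo gens C d).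

Lemma size_gens_seq : size (gens_seq C d) = d.+4.
Proof. by rewrite size_cat size_map size_iota /=; lia. Qed.

Lemma ev_var k : (k < d.+4)%N -> ev 'X_(inord k) = (gens_seq C d)`_k.
Proof.
move=> hk; rewrite comp_mpolyXU inordK // -[k]/(nat_of_ord (Ordinal hk)) -tnth_nth.
by rewrite tnth_mktuple.
Qed.

Lemma ev_q : ev (var_q C d) = x * y. Proof. exact: ev_var. Qed.
Lemma ev_r : ev (var_r C d) = x ^+ d + y ^+ d. Proof. exact: ev_var. Qed.
Lemma ev_Q : ev (var_Q C d) = X * Y. Proof. exact: ev_var. Qed.
Lemma ev_R : ev (var_R C d) = X ^+ d + Y ^+ d. Proof. exact: ev_var. Qed.
Lemma ev_eu : ev (var_eu C d) = x * X + y * Y.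
Proof. by rewrite ev_var //; lia. Qed.

Lemma ev_a i : (i <= d)%N ->
  ev (var_a C d i) = x ^+ (d - i) * Y ^+ i + y ^+ (d - i) * X ^+ i.
Proof.
rewrite /var_a; case: eqVneq => [-> _|i0].
  by rewrite ev_r subn0 !expr0 !mulr1.
case: eqVneq => [-> _|id hi]; first by rewrite ev_R subnn !expr0 !mul1r addrC.
rewrite ev_var; last lia.
case: i i0 id hi => // i _ id hi; rewrite /gens_seq nth_cat /= -/(index_iota 1 d).
rewrite (nth_map 0%N) ?size_iota; last lia.
rewrite nth_iota; last lia.
by have -> : (1 + (4 + i.+1 - 5) = i.+1)%N by lia.
Qed.

Lemma ev_eu_pow k : ev (var_eu_pow C d k) = (x * X) ^+ k + (y * Y) ^+ k.
Proof.
rewrite /var_eu_pow rmorph_eu_pow /= rmorphM /= ev_eu ev_q ev_Q.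
by rewrite (_ : x * y * (X * Y) = (x * X) * (y * Y)) ?eu_powE //; ring.
Qed.

Lemma ev_rel_Z i : (0 < i < d)%N -> ev (rel_Z C d i) = 0.
Proof.
case: i => // i /andP[_ hi].
rewrite /rel_Z rmorphB rmorphD !rmorphM /= ev_eu ev_q ev_Q !ev_a; try lia.
have -> : (d - i = (d - i.+2).+2)%N by lia.
have -> : (d - i.+1 = (d - i.+2).+1)%N by lia.
by rewrite !exprS; ring.
Qed.

(** In the expansion of a_i a_j the two mixed products give [q^(d-j) Q^i eu^(j-i)]. The other two
    are half of the expansion of [r a_(i+j)], [r R] or [R a_(i+j-d)], and the last term of each case
    removes the other half. The slack variables [l], [k], [t] eliminate truncated subtraction before
    [ring]. *)
Lemma ev_rel_ZZ i j : (0 < i)%N -> (i <= j < d)%N -> ev (rel_ZZ C d i j) = 0.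
Proof.
move=> i0 /andP[hij hj].
rewrite /rel_ZZ rmorphB rmorphD !rmorphM !rmorphXn /= ev_q ev_Q ev_eu_pow !ev_a; try lia.
case: ltnP => hij'.
  rewrite rmorphB !rmorphM rmorphXn /= ev_r ev_q ev_eu_pow ev_a; try lia.
  have [l el] : exists l, j = (i + l)%N by exists (j - i)%N; lia.
  have [k ek] : exists k, d = (i + i + l + k)%N by exists (d - i - j)%N; lia.
  have -> : (d - i = i + l + k)%N by lia.
  have -> : (d - j = i + k)%N by lia.
  have -> : (d - (i + j) = k)%N by lia.
  have -> : (i + l + k - j = k)%N by lia.
  have -> : (j - i = l)%N by lia.
  by rewrite ek el !exprMn !exprD; ring.
case: eqVneq => [e|ne].
  rewrite rmorphB !rmorphM /= ev_r ev_R ev_eu_pow.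
  have [l el] : exists l, j = (i + l)%N by exists (j - i)%N; lia.
  have -> : (d - i = j)%N by lia.
  have -> : (d - j = i)%N by lia.
  have -> : (j - i = l)%N by lia.
  by rewrite -e el !exprMn !exprD; ring.
rewrite rmorphB !rmorphM rmorphXn /= ev_R ev_Q ev_eu_pow ev_a; try lia.
have [l el] : exists l, j = (i + l)%N by exists (j - i)%N; lia.
have [k ek] : exists k, d = (j + k)%N by exists (d - j)%N; lia.
have [t et] : exists t, i = (k + t)%N by exists (i - k)%N; lia.
have -> : (d - i = l + k)%N by lia.
have -> : (d - j = k)%N by lia.
have -> : (i + j - d = t)%N by lia.
have -> : (2 * d - i - j = k + k + l)%N by lia.
have -> : (d - t = k + l + k)%N by lia.
have -> : (j - i = l)%N by lia.
by rewrite ek el et !exprMn !exprD; ring.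
Qed.

(* The single relation for d = 1, where the list relations is empty. *)
Definition rel_one : {mpoly C[d.+4]} :=
  var_eu C d * (var_r C d * var_R C d - var_eu C d)
  - (var_Q C d * (var_r C d ^+ 2 - 2 *: var_q C d)
     + var_q C d * (var_R C d ^+ 2 - 2 *: var_Q C d)).

Definition all_relations : seq {mpoly C[d.+4]} :=
  if d == 1%N then [:: rel_one] else relations C d.

(** For [d = 1], [r R - eu] is [x Y + y X], the conjugate of eu under the swap of [X] and [Y] alone;
    the relation evaluates the product of the two conjugates. *)
Lemma ev_rel_one : d = 1%N -> ev rel_one = 0.
Proof.
move=> d1; rewrite /rel_one -!mul_mpolyC mpolyC_nat.
rewrite !(rmorphB, rmorphD, rmorphM, rmorph_nat) /= ev_q ev_Q ev_r ev_R ev_eu d1 !expr1.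
by ring.
Qed.

Lemma relationsP f : reflect
  ((exists2 i, (0 < i < d)%N & f = rel_Z C d i) \/
   (exists i j, [/\ (0 < i)%N, (i <= j < d)%N & f = rel_ZZ C d i j]))
  (f \in relations C d).
Proof.
rewrite mem_cat; apply: (iffP orP) => -[].
- by case/mapP => i; rewrite mem_index_iota => hi ->; left; exists i.
- case/allpairsPdep => i [j []]; rewrite !mem_index_iota => /andP[hi _] hj ->.
  by right; exists i, j.
- by case=> i hi ->; left; apply/map_f; rewrite mem_index_iota.
case=> i [j [i0 hij ->]]; right; apply/allpairsPdep; exists i, j.
by split=> //; rewrite mem_index_iota //; lia.
Qed.

Lemma ev_all_relations f : f \in all_relations -> ev f = 0.
Proof.
rewrite /all_relations; case: eqVneq => [d1|_].
  by rewrite inE => /eqP ->; exact: ev_rel_one.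
case/relationsP => [[i hi ->]|[i [j [i0 hij ->]]]]; first exact: ev_rel_Z.
exact: ev_rel_ZZ.
Qed.

Lemma reducible_mod_all_relations p : reducible (ideal_gen all_relations) p.
Proof.
have h f : d != 1%N -> f \in relations C d -> ideal_gen all_relations f.
  by move=> d1 hf; apply: ideal_gen_mem; rewrite /all_relations (negPf d1).
have I0 := ideal_gen0 all_relations.
have IB := @ideal_genB _ all_relations.
have IM := @ideal_genM _ all_relations.
have IZ i : (0 < i < d)%N -> ideal_gen all_relations (rel_Z C d i).
  by move=> hi; apply: h; [lia|apply/relationsP; left; exists i].
have IZZ i j : (0 < i)%N -> (i <= j < d)%N -> ideal_gen all_relations (rel_ZZ C d i j).
  by move=> hi hij; apply: h; [lia|apply/relationsP; right; exists i, j].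
apply: reducible_all => //.
case: (eqVneq d 1%N) => [d1|d1]; last by apply: reducible_eu_top => //; lia.
have R1 : reducible (ideal_gen all_relations) 1 by apply: (@reducible_eX _ _ _ _ 0).
pose e := var_eu C d; pose q := var_q C d; pose r := var_r C d.
pose Q := var_Q C d; pose R := var_R C d.
(* [rel_one] solved for [eu^2], bracketed so that each product peels off one coefficient at a time
   and ends in 1 or eu. *)
pose e2 : {mpoly C[d.+4]} := r * (R * e ^+ 1) - (Q * (r * (r * 1)) - 2 *: (Q * (q * 1))
     + (q * (R * (R * 1)) - 2 *: (q * (Q * 1)))).
have he : ideal_gen all_relations (e ^+ d.+1 - e2).
  suff -> : e ^+ d.+1 - e2 = 0 - rel_one.
    by apply: IB => //; apply: ideal_gen_mem; rewrite /all_relations (introT eqP d1) inE.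
  have -> : e ^+ d.+1 = e ^+ 2 by congr (_ ^+ _); rewrite d1.
  by rewrite /e2 /rel_one -/e -/q -/r -/Q -/R -!mul_mpolyC mpolyC_nat; ring.
apply: (reducible_eqmod I0 IB he).
have Re : reducible (ideal_gen all_relations) (e ^+ 1) by apply: reducible_eX.
have RQ f := @reducible_Q _ _ _ IM f; have Rq f := @reducible_q _ _ _ IM f.
have RR f := @reducible_R _ _ _ IM f; have Rr f := @reducible_r _ _ _ IM f.
have RZ a f := @reducibleZ _ _ _ IM a f.
have RD f g := @reducibleD _ _ _ I0 IB f g.
have RB f g := @reducibleB _ _ _ I0 IB IM f g.
by apply/RB; [exact/Rr/RR|apply/RD; apply/RB;
  [exact/RQ/Rr/Rr|exact/RZ/RQ/Rq|exact/Rq/RR/RR|exact/RZ/Rq/RQ]].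
Qed.

Definition inv_fund : 4.-tuple {mpoly C[2 + 2]} :=
  [tuple inv_q C; inv_r C d; inv_Q C; inv_R C d].

Lemma ev_emb c : ev (emb d c) = c \mPo inv_fund.
Proof.
rewrite comp_mpolyA; congr (_ \mPo _); apply: eq_from_tnth => i.
rewrite tnth_mktuple !(tnth_nth 0).
case: i => [[|[|[|[|i]]]] hi] //=; [exact: ev_q|exact: ev_r|exact: ev_Q|exact: ev_R].
Qed.

Lemma ev_normal_form c a : ev (normal_form d c a) =
  \sum_(0 <= k < d.+1) (c k \mPo inv_fund) * inv_eu C ^+ k
  + \sum_(1 <= i < d) (a i \mPo inv_fund) * inv_a C d i.
Proof.
rewrite /normal_form rmorphD !rmorph_sum /=; congr (_ + _).
  by apply: eq_bigr => k _; rewrite rmorphM rmorphXn /= ev_emb ev_eu.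
apply: eq_big_nat => i /andP[_ hi].
by rewrite rmorphM /= ev_emb ev_a // ltnW.
Qed.

Lemma meval_inv_fund c x y X Y :
  (c \mPo inv_fund).@[pt x y X Y] = c.@[fund d x y X Y].
Proof.
rewrite comp_mpoly_meval; apply: meval_eq => i; rewrite (tnth_nth 0).
by case: i => [[|[|[|[|i]]]] hi] //=; rewrite ?(mevalD, mevalM, rmorphXn) /= !mevalXU.
Qed.

Variable zeta : C.
Hypothesis hz : d.-primitive_root zeta.

Lemma normal_form_independence (c a : nat -> {mpoly C[4]}) :
  \sum_(0 <= k < d.+1) (c k \mPo inv_fund) * inv_eu C ^+ k
  + \sum_(1 <= i < d) (a i \mPo inv_fund) * inv_a C d i = 0 ->
  (forall k, (k <= d)%N -> c k = 0) /\ (forall i, (0 < i < d)%N -> a i = 0).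
Proof.
move=> h; apply: (fund_independence hd hz) => x y X Y.
rewrite -[RHS](meval0 (pt x y X Y)) -h mevalD !raddf_sum /=.
congr (_ + _); apply: eq_bigr => k _; rewrite mevalM meval_inv_fund; congr (_ * _).
  by rewrite rmorphXn /= mevalD !mevalM !mevalXU.
by rewrite mevalD !mevalM !rmorphXn /= !mevalXU.
Qed.

Lemma ev_ideal p : ideal_gen all_relations p -> ev p = 0.
Proof.
move: p; apply: ideal_gen_ind; last exact: ev_all_relations.
- exact: comp_mpoly0.
- by move=> f g hf hg; rewrite comp_mpolyD hf hg addr0.
- by move=> g f hf; rewrite rmorphM /= hf mulr0.
Qed.

Lemma kernelP p : ev p = 0 <-> ideal_gen all_relations p.
Proof.
split; last exact: ev_ideal.
move=> hp; have [c [a hI]] := reducible_mod_all_relations p.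
have := ev_ideal hI.
rewrite comp_mpolyB hp sub0r => /eqP; rewrite oppr_eq0 ev_normal_form => /eqP.
case/normal_form_independence => hc ha.
suff nf0 : normal_form d c a = 0 by rewrite nf0 subr0 in hI.
rewrite /normal_form !big_nat !big1 ?addr0 // => k hk; rewrite ?hc ?ha //;
  by rewrite /emb comp_mpoly0 mul0r.
Qed.

End Presentation.

(** * Invariants of W *)

Section Subalgebra.

Variables (C : fieldType) (k n : nat) (s : n.-tuple {mpoly C[k]}).

Lemma subalgebra_genB f g :
  subalgebra_gen s f -> subalgebra_gen s g -> subalgebra_gen s (f - g).
Proof. by move=> [p ->] [p' ->]; exists (p - p'); rewrite comp_mpolyB. Qed.

Lemma subalgebra_genM f g :
  subalgebra_gen s f -> subalgebra_gen s g -> subalgebra_gen s (f * g).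
Proof. by move=> [p ->] [p' ->]; exists (p * p'); rewrite rmorphM. Qed.

Lemma subalgebra_genX f j : subalgebra_gen s f -> subalgebra_gen s (f ^+ j).
Proof. by move=> [p ->]; exists (p ^+ j); rewrite rmorphXn. Qed.

Lemma subalgebra_genZ c f : subalgebra_gen s f -> subalgebra_gen s (c *: f).
Proof. by move=> [p ->]; exists (c *: p); rewrite comp_mpolyZ. Qed.

Lemma subalgebra_gen0 : subalgebra_gen s 0.
Proof. by exists 0; rewrite comp_mpoly0. Qed.

Lemma subalgebra_gen1 : subalgebra_gen s 1.
Proof. by exists 1; rewrite comp_mpoly1. Qed.

Lemma subalgebra_genD f g :
  subalgebra_gen s f -> subalgebra_gen s g -> subalgebra_gen s (f + g).
Proof. by move=> [p ->] [p' ->]; exists (p + p'); rewrite comp_mpolyD. Qed.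

Lemma subalgebra_gen_sum (J : eqType) (r : seq J) (F : J -> {mpoly C[k]}) :
  (forall j, j \in r -> subalgebra_gen s (F j)) ->
  subalgebra_gen s (\sum_(j <- r) F j).
Proof.
move=> h; rewrite big_seq; apply: big_ind => //; first exact: subalgebra_gen0.
exact: subalgebra_genD.
Qed.

Lemma subalgebra_gen_tnth i : subalgebra_gen s (tnth s i).
Proof. by exists 'X_i; rewrite comp_mpolyXU (tnth_nth 0). Qed.

Lemma subalgebra_gen_mem f : f \in s -> subalgebra_gen s f.
Proof. by case/tnthP => i ->; apply: subalgebra_gen_tnth. Qed.

Lemma subalgebra_gen_comp l (t : l.-tuple {mpoly C[k]}) (p : {mpoly C[l]}) :
  (forall i, subalgebra_gen s (tnth t i)) -> subalgebra_gen s (p \mPo t).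
Proof.
move=> /(@fin_all_exists _ _ _) [u hu]; exists (p \mPo [tuple u i | i < l]).
rewrite comp_mpolyA; congr (_ \mPo _); apply: eq_from_tnth => i.
by rewrite !tnth_mktuple hu.
Qed.

End Subalgebra.

Section Action.

Variables (C : fieldType) (zeta : C).
Hypothesis z0 : zeta != 0.

Lemma act_lshift (w : 'M[C]_2) j :
  act w 'X_(lshift 2 j) = \sum_(i < 2) w i j *: 'X_(lshift 2 i).
Proof.
rewrite /act comp_mpolyXU -tnth_nth tnth_mktuple.
by rewrite -[lshift 2 j]/(unsplit (inl j)) unsplitK.
Qed.

Lemma act_rshift (w : 'M[C]_2) j :
  act w 'X_(rshift 2 j) = \sum_(i < 2) (invmx w) j i *: 'X_(rshift 2 i).
Proof.
rewrite /act comp_mpolyXU -tnth_nth tnth_mktuple.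
by rewrite -[rshift 2 j]/(unsplit (inr j)) unsplitK.
Qed.

Lemma act_mulmx (w1 w2 : 'M[C]_2) f : w1 \in unitmx -> w2 \in unitmx ->
  act (w1 *m w2) f = act w1 (act w2 f).
Proof.
move=> u1 u2; rewrite {2 3}/act comp_mpolyA; congr (_ \mPo _).
apply: eq_from_tnth => k; rewrite !tnth_mktuple.
case: (split k) => j; rewrite raddf_sum /=.
  under eq_bigr do rewrite mxE scaler_suml.
  rewrite exchange_big /=; apply: eq_bigr => i _.
  rewrite comp_mpolyZ -/(act w1 _) act_lshift scaler_sumr.
  by apply: eq_bigr => l _; rewrite scalerA mulrC.
have -> : invmx (w1 *m w2) = invmx w2 *m invmx w1.
  have u12 : w1 *m w2 \in unitmx by rewrite unitmx_mul u1.
  apply: (can_inj (mulmxK u12)); rewrite mulVmx //.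
  by rewrite mulmxA -(mulmxA (invmx w2)) mulVmx // mulmx1 mulVmx.
under eq_bigr do rewrite mxE scaler_suml.
rewrite exchange_big /=; apply: eq_bigr => i _.
rewrite comp_mpolyZ -/(act w1 _) act_rshift scaler_sumr.
by apply: eq_bigr => l _; rewrite scalerA.
Qed.

Lemma act1 (f : {mpoly C[2 + 2]}) : act 1%:M f = f.
Proof.
rewrite -[RHS]comp_mpoly_id; congr (_ \mPo _).
apply: eq_from_tnth => k; rewrite !tnth_mktuple -[in RHS](splitK k).
case: (split k) => j; rewrite (bigD1 j) //= ?invmx1 mxE eqxx scale1r;
  rewrite big1 ?addr0 // => i;
  by rewrite ?invmx1 mxE ?[j == i]eq_sym => /negPf ->; rewrite scale0r.
Qed.

Lemma s_K i : s_ zeta i *m s_ zeta i = 1%:M.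
Proof.
apply/matrixP => a b; rewrite !mxE !big_ord_recl big_ord0 !mxE /=.
have zi : zeta ^+ i != 0 by rewrite expf_neq0.
by case: a => [[|[|a]] ha] //; case: b => [[|[|b]] hb] //=;
  rewrite ?(mulr0, mul0r, addr0, add0r) ?mulfV ?mulVf.
Qed.

Lemma s_unit i : s_ zeta i \in unitmx.
Proof. by case: (mulmx1_unit (s_K i)). Qed.

Lemma s_V i : invmx (s_ zeta i) = s_ zeta i.
Proof. by rewrite -[LHS]mulmx1 -(s_K i) mulKmx ?s_unit. Qed.

Lemma act_s_x i : act (s_ zeta i) (vx C) = zeta ^- i *: vy C.
Proof.
rewrite /vx act_lshift !big_ord_recl big_ord0 !mxE /= scale0r add0r addr0.
by congr (_ *: 'X_ _); apply: val_inj.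
Qed.

Lemma act_s_y i : act (s_ zeta i) (vy C) = zeta ^+ i *: vx C.
Proof.
rewrite /vy act_lshift !big_ord_recl big_ord0 !mxE /= scale0r !addr0.
by congr (_ *: 'X_ _); apply: val_inj.
Qed.

Lemma act_s_X i : act (s_ zeta i) (vX C) = zeta ^+ i *: vY C.
Proof.
rewrite /vX act_rshift s_V !big_ord_recl big_ord0 !mxE /= scale0r add0r addr0.
by congr (_ *: 'X_ _); apply: val_inj.
Qed.

Lemma act_s_Y i : act (s_ zeta i) (vY C) = zeta ^- i *: vX C.
Proof.
rewrite /vY act_rshift s_V !big_ord_recl big_ord0 !mxE /= scale0r !addr0.
by congr (_ *: 'X_ _); apply: val_inj.
Qed.

(** [act_mulmx] is restricted to invertible matrices, so the induction over [in_W] proves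
    invertibility along with invariance. *)
Lemma W_invariantP f : W_invariant zeta f <->
  act (s_ zeta 0) f = f /\ act (s_ zeta 1) f = f.
Proof.
split=> [h|[h0 h1] w hw].
  by split; apply: h; [apply: in_W_s0|apply: in_W_s1].
suff [] : w \in unitmx /\ act w f = f by [].
elim: hw => [||| w1 w2 _ [u1 e1] _ [u2 e2]|w1 _ [u1 e1]].
- by rewrite s_unit.
- by rewrite s_unit.
- by rewrite unitmx1 act1.
- by rewrite unitmx_mul u1 u2 act_mulmx // e2.
- have u1' : invmx w1 \in unitmx by rewrite unitmx_inv.
  by have := act_mulmx f u1' u1; rewrite mulVmx // act1 e1 => <-.
Qed.

End Action.

(** * Orbit sums and generation of the invariants *)

Section Generation.

Variables (C : numClosedFieldType) (d : nat) (zeta : C).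
Hypotheses (hd : (0 < d)%N) (hz : d.-primitive_root zeta).

Local Notation x := (vx C).
Local Notation y := (vy C).
Local Notation X := (vX C).
Local Notation Y := (vY C).
Local Notation generated := (subalgebra_gen (gens C d)).

Let z0 : zeta != 0.
Proof.
have : zeta ^+ d = 1 by apply: prim_expr_order.
by apply: contra_eq_neq => ->; rewrite expr0n gtn_eqF // eq_sym oner_eq0.
Qed.

(** A monomial plus its image under [s_ zeta 0], hence twice the monomial when it is fixed. *)
Definition orbit_sum (a b c e : nat) : {mpoly C[2 + 2]} :=
  x ^+ a * y ^+ b * X ^+ c * Y ^+ e + x ^+ b * y ^+ a * X ^+ e * Y ^+ c.

Lemma orbit_sumC a b c e : orbit_sum a b c e = orbit_sum b a e c.
Proof. exact: addrC. Qed.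

(* The monomial x^a y^b X^c Y^e is invariant under the rotations in W. *)
Definition weight0 a b c e := exists u v, (a + e + u * d = b + c + v * d)%N.

Lemma multiple_geq n u v : (0 < n)%N -> (n + v * d = u * d)%N -> (d <= n)%N.
Proof.
move=> n0 h; have : (v * d < u * d)%N by lia.
rewrite ltn_pmul2r // => vu; move: h; rewrite -(subnKC vu) mulnDl mulSn; lia.
Qed.

Lemma generated_a i : (i <= d)%N ->
  generated (x ^+ (d - i) * Y ^+ i + y ^+ (d - i) * X ^+ i).
Proof. by move=> hi; exists (var_a C d i); rewrite ev_a. Qed.

Lemma generated_q : generated (x * y). Proof. by exists (var_q C d); rewrite ev_q. Qed.
Lemma generated_Q : generated (X * Y). Proof. by exists (var_Q C d); rewrite ev_Q. Qed.
Lemma generated_r : generated (x ^+ d + y ^+ d).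
Proof. by exists (var_r C d); rewrite ev_r. Qed.
Lemma generated_R : generated (X ^+ d + Y ^+ d).
Proof. by exists (var_R C d); rewrite ev_R. Qed.
Lemma generated_eu : generated (x * X + y * Y).
Proof. by exists (var_eu C d); rewrite ev_eu. Qed.

Section Step.

Variable n : nat.
Hypothesis IH : forall a b c e, (a + b + c + e < n)%N -> weight0 a b c e ->
  generated (orbit_sum a b c e).

Lemma generated_divq a b c e : (a + b + c + e <= n)%N -> weight0 a b c e ->
  (0 < a)%N -> (0 < b)%N -> generated (orbit_sum a b c e).
Proof.
case: a b => [|a] [|b] // hn [u [v huv]] _ _.
have -> : orbit_sum a.+1 b.+1 c e = x * y * orbit_sum a b c e.
  by rewrite /orbit_sum !exprS; ring.
by apply/subalgebra_genM/IH; [exact: generated_q|lia|exists u, v; lia].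
Qed.

Lemma generated_divQ a b c e : (a + b + c + e <= n)%N -> weight0 a b c e ->
  (0 < c)%N -> (0 < e)%N -> generated (orbit_sum a b c e).
Proof.
case: c e => [|c] [|e] // hn [u [v huv]] _ _.
have -> : orbit_sum a b c.+1 e.+1 = X * Y * orbit_sum a b c e.
  by rewrite /orbit_sum !exprS; ring.
by apply/subalgebra_genM/IH; [exact: generated_Q|lia|exists u, v; lia].
Qed.

(* If u divides the monomial m and s is the swap of x, y and X, Y, then
   m + s m = (u + s u) (m / u + s (m / u)) - (v + s v) for v = (s u) (m / u),
   and u is chosen such that v is divisible by x y or X Y. *)
Lemma generated_xX a c : (a + c <= n)%N -> weight0 a 0 c 0 ->
  generated (orbit_sum a 0 c 0).
Proof.
move=> hn [u [v huv]].
(* The factor [u] is [X^d] if [a = 0], [x^d] if [c = 0], and [x X] otherwise; orbit sums equal to R,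
   r or eu are handled first, as there [v] has no factor [x y] or [X Y]. *)
case: a c hn huv => [|a] [|c] hn huv.
- have -> : orbit_sum 0 0 0 0 = 1 + 1 by rewrite /orbit_sum !expr0 !mulr1.
  by apply: subalgebra_genD; apply: subalgebra_gen1.
- have hc : (d <= c.+1)%N by apply: (@multiple_geq _ u v); lia.
  case: (eqVneq c.+1 d) => [->|nc].
    have -> : orbit_sum 0 0 d 0 = X ^+ d + Y ^+ d by rewrite /orbit_sum !expr0; ring.
    exact: generated_R.
  have -> : orbit_sum 0 0 c.+1 0
      = (X ^+ d + Y ^+ d) * orbit_sum 0 0 (c.+1 - d) 0 - orbit_sum 0 0 (c.+1 - d) d.
    by rewrite -{1}(subnKC hc) /orbit_sum !expr0 !exprD; ring.
  apply: subalgebra_genB; last by apply: generated_divQ; [lia|exists u, v.+2; lia|lia|lia].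
  apply: subalgebra_genM; first exact: generated_R.
  by apply: IH; [lia|exists u, v.+1; lia].
- have ha : (d <= a.+1)%N by apply: (@multiple_geq _ v u); lia.
  case: (eqVneq a.+1 d) => [->|na].
    have -> : orbit_sum d 0 0 0 = x ^+ d + y ^+ d by rewrite /orbit_sum !expr0; ring.
    exact: generated_r.
  have -> : orbit_sum a.+1 0 0 0
      = (x ^+ d + y ^+ d) * orbit_sum (a.+1 - d) 0 0 0 - orbit_sum (a.+1 - d) d 0 0.
    by rewrite -{1}(subnKC ha) /orbit_sum !expr0 !exprD; ring.
  apply: subalgebra_genB; last by apply: generated_divq; [lia|exists u.+2, v; lia|lia|lia].
  apply: subalgebra_genM; first exact: generated_r.
  by apply: IH; [lia|exists u.+1, v; lia].
case: (posnP (a + c)) => [/eqP|ac0].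
  rewrite addn_eq0 => /andP[/eqP -> /eqP ->].
  have -> : orbit_sum 1 0 1 0 = x * X + y * Y by rewrite /orbit_sum !expr0; ring.
  exact: generated_eu.
have -> : orbit_sum a.+1 0 c.+1 0
    = (x * X + y * Y) * orbit_sum a 0 c 0 - orbit_sum a 1 c 1.
  by rewrite /orbit_sum !expr0 !exprS; ring.
apply: subalgebra_genB.
  apply: subalgebra_genM; first exact: generated_eu.
  by apply: IH; [lia|exists u, v; lia].
case: (posnP a) => [a0|a0].
  by apply: generated_divQ; [lia|exists u, v; lia|lia|lia].
by apply: generated_divq; [lia|exists u, v; lia|lia|lia].
Qed.

(** The factor split off is [x^(d-i) Y^i], a monomial of a_i. It divides because [a + e] is a
    positive multiple of [d]; capping [i] at [d - 1] keeps a factor [x], so that the swapped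
    monomial contains [y]. *)
Lemma generated_xY a e : (a + e <= n)%N -> weight0 a 0 0 e ->
  generated (orbit_sum a 0 0 e).
Proof.
case: (posnP e) => [-> |e0]; first exact: generated_xX.
case: (posnP a) => [-> hn [u [v huv]]|a0].
  by rewrite orbit_sumC; apply: generated_xX => //; exists v, u; lia.
move=> hn [u [v huv]].
have hae : (d <= a + e)%N by apply: (@multiple_geq _ v u); lia.
pose i := minn e d.-1.
have [ha he] : (d - i <= a)%N /\ (i <= e)%N by rewrite /i; lia.
have hid : (i < d)%N by rewrite /i; lia.
set a' := (a - (d - i))%N; set e' := (e - i)%N.
have Ea : a = (d - i + a')%N by rewrite subnKC.
have Ee : e = (i + e')%N by rewrite subnKC.
case: (eqVneq (a' + e') 0) => [/eqP|ae0].
  rewrite addn_eq0 => /andP[/eqP a'0 /eqP e'0].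
  have -> : orbit_sum a 0 0 e = x ^+ (d - i) * Y ^+ i + y ^+ (d - i) * X ^+ i.
    by rewrite Ea Ee a'0 e'0 !addn0 /orbit_sum !expr0; ring.
  exact/generated_a/ltnW.
have -> : orbit_sum a 0 0 e = (x ^+ (d - i) * Y ^+ i + y ^+ (d - i) * X ^+ i)
     * orbit_sum a' 0 0 e' - orbit_sum a' (d - i) i e'.
  by rewrite {1}Ea {1}Ee /orbit_sum !expr0 !exprD; ring.
apply: subalgebra_genB.
  apply: subalgebra_genM; first exact/generated_a/ltnW.
  by apply: IH; [lia|exists u.+1, v; lia].
case: (posnP a') => [a'0|a'0]; last first.
  by apply: generated_divq; [lia|exists u.+2, v; lia|lia|lia].
case: (posnP i) => [i0|i0]; last first.
  by apply: generated_divQ; [lia|exists u.+2, v; lia|lia|lia].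
(* As [e > 0], [i = 0] happens only for [d = 1]; the remaining monomial is then in [y] and [Y] and
   is the swap of one in [x] and [X]. *)
rewrite a'0 i0 subn0 orbit_sumC; apply: generated_xX; first lia.
by exists v, u.+2; lia.
Qed.

Lemma generated_step a b c e : (a + b + c + e <= n)%N -> weight0 a b c e ->
  generated (orbit_sum a b c e).
Proof.
have key a' c' e' : (a' + c' + e' <= n)%N -> weight0 a' 0 c' e' ->
    generated (orbit_sum a' 0 c' e').
  case: (posnP c') => [->|c0]; first by rewrite addn0; apply: generated_xY.
  case: (posnP e') => [->|e0]; first by rewrite addn0; apply: generated_xX.
  by move=> hn hw; apply: generated_divQ => //; rewrite addn0.
move=> hn hw; case: (posnP b) => [b0|b0].
  by subst b; apply: key => //; rewrite addn0 in hn.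
case: (posnP a) => [a0|a0]; last exact: generated_divq.
subst a; rewrite orbit_sumC; apply: key; first lia.
by have [u [v huv]] := hw; exists v, u; lia.
Qed.

End Step.

Lemma generated_orbit_sum a b c e : weight0 a b c e -> generated (orbit_sum a b c e).
Proof.
move: {2}(a + b + c + e)%N (leqnn (a + b + c + e)) => n.
elim/ltn_ind: n a b c e => n IH a b c e hn.
apply: (@generated_step n) => // a' b' c' e' h'.
by apply: (IH (a' + b' + c' + e')%N).
Qed.

Lemma actD w (f g : {mpoly C[2 + 2]}) : act w (f + g) = act w f + act w g.
Proof. exact: rmorphD. Qed.

Lemma actZ w k (f : {mpoly C[2 + 2]}) : act w (k *: f) = k *: act w f.
Proof. exact: comp_mpolyZ. Qed.

Lemma act_sum w (J : Type) (t : seq J) (F : J -> {mpoly C[2 + 2]}) :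
  act w (\sum_(j <- t) F j) = \sum_(j <- t) act w (F j).
Proof. exact: raddf_sum. Qed.

Lemma actM w (f g : {mpoly C[2 + 2]}) : act w (f * g) = act w f * act w g.
Proof. exact: rmorphM. Qed.

Lemma actX w (f : {mpoly C[2 + 2]}) k : act w (f ^+ k) = act w f ^+ k.
Proof. exact: rmorphXn. Qed.

Lemma mpolyX4 (m : 'X_{1..2 + 2}) : 'X_[C, m] = x ^+ m (lshift 2 ord0)
  * y ^+ m (lshift 2 ord_max) * X ^+ m (rshift 2 ord0) * Y ^+ m (rshift 2 ord_max).
Proof.
rewrite mpolyXE_id !big_ord_recl big_ord0 mulr1 !mulrA /vx /vy /vX /vY.
by do !congr (_ * _); congr ('X_ _ ^+ m _); apply: val_inj.
Qed.

Lemma act_s_monomial i a b c e :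
  act (s_ zeta i) (x ^+ a * y ^+ b * X ^+ c * Y ^+ e)
  = ((zeta ^+ i) ^+ (b + c) / (zeta ^+ i) ^+ (a + e))
    *: (x ^+ b * y ^+ a * X ^+ e * Y ^+ c).
Proof.
rewrite !actM !actX act_s_x act_s_y act_s_X // act_s_Y // !exprZn.
rewrite -!mul_mpolyC !exprVn !exprD invfM !mpolyCM; ring.
Qed.

(** The rotation [s_0 s_1] is diagonal on monomials, so every monomial in the support of [f] is
    itself rotation invariant. Averaging [f] with its image under [s_0] then writes it through orbit
    sums. *)
Lemma generated_of_invariant f : W_invariant zeta f -> generated f.
Proof.
case/(W_invariantP z0) => h0 h1.
pose M (m : 'X_{1..2 + 2}) := x ^+ m (lshift 2 ord0)
  * y ^+ m (lshift 2 ord_max) * X ^+ m (rshift 2 ord0) * Y ^+ m (rshift 2 ord_max).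
pose M' (m : 'X_{1..2 + 2}) := x ^+ m (lshift 2 ord_max)
  * y ^+ m (lshift 2 ord0) * X ^+ m (rshift 2 ord_max) * Y ^+ m (rshift 2 ord0).
pose p m := (m (lshift 2 ord0) + m (rshift 2 ord_max))%N.
pose n m := (m (lshift 2 ord_max) + m (rshift 2 ord0))%N.
have fE : f = \sum_(m <- msupp f) f@_m *: M m.
  by rewrite {1}(mpolyE f); apply: eq_bigr => m _; rewrite mpolyX4.
have sE i : act (s_ zeta i) f =
    \sum_(m <- msupp f) f@_m *: (((zeta ^+ i) ^+ n m / (zeta ^+ i) ^+ p m) *: M' m).
  rewrite {1}fE act_sum; apply: eq_bigr => m _.
  by rewrite actZ act_s_monomial.
have hw m : m \in msupp f -> zeta ^+ n m = zeta ^+ p m.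
  move=> hm; have fm0 : f@_m != 0 by rewrite -mcoeff_msupp.
  have : f@_m * (zeta ^+ n m / zeta ^+ p m) = f@_m.
    rewrite -[in RHS]h0 -[in RHS]h1 sE act_sum raddf_sum /=.
    rewrite (bigD1_seq m) ?msupp_uniq //= [X in _ = _ + X]big1 ?addr0; last first.
      move=> m' ne; rewrite !actZ act_s_monomial -/(M m').
      by rewrite -[M m']mpolyX4 !mcoeffZ mcoeffX (negPf ne) !mulr0.
    rewrite !actZ act_s_monomial -/(M m) -[M m]mpolyX4.
    by rewrite !mcoeffZ mcoeffX eqxx expr0 !expr1n divr1 !mulr1 expr1.
  rewrite -[RHS]mulr1 => /(mulfI fm0) /(congr1 (fun t => t * zeta ^+ p m)).
  by rewrite mul1r divfK // expf_neq0.
have -> : f = 2^-1 *: \sum_(m <- msupp f) f@_m *: (M m + M' m).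
  apply: (scalerI (a := 2)); first by rewrite pnatr_eq0.
  rewrite scalerA mulfV ?pnatr_eq0 // scale1r.
  under eq_bigr do rewrite scalerDr.
  rewrite big_split /= -fE scaler_nat mulr2n -{2}h0 sE; congr (_ + _).
  by apply: eq_bigr => m _; rewrite expr0 !expr1n divr1 scale1r.
apply/subalgebra_genZ/subalgebra_gen_sum => m hm; apply: subalgebra_genZ.
apply: (generated_orbit_sum (b := m _) (c := m _)).
have /eqP := hw m hm; rewrite (eq_prim_root_expr hz) => /eqP hmod.
(* Equal remainders modulo [d], so the quotients, exchanged, balance the two sides. *)
exists (n m %/ d)%N, (p m %/ d)%N; rewrite -/(p m) -/(n m).
by rewrite {1}(divn_eq (p m) d) {2}(divn_eq (n m) d) hmod; lia.
Qed.

Lemma act_s_monomial_weight0 i a b c e : weight0 a b c e ->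
  act (s_ zeta i) (x ^+ a * y ^+ b * X ^+ c * Y ^+ e)
  = x ^+ b * y ^+ a * X ^+ e * Y ^+ c.
Proof.
move=> [u [v huv]]; rewrite act_s_monomial.
suff -> : (zeta ^+ i) ^+ (b + c) = (zeta ^+ i) ^+ (a + e).
  by rewrite divff ?scale1r // !expf_neq0.
have zk k : (zeta ^+ i) ^+ (k * d) = 1.
  by rewrite -exprM mulnA mulnC exprM (prim_expr_order hz) expr1n.
by rewrite -[LHS]mulr1 -(zk v) -exprD -huv exprD zk mulr1.
Qed.

Lemma orbit_sum_invariant a b c e : weight0 a b c e ->
  W_invariant zeta (orbit_sum a b c e).
Proof.
move=> hw; have hw' : weight0 b a e c by case: hw => u [v huv]; exists v, u; lia.
apply/(W_invariantP z0); split;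
  by rewrite /orbit_sum actD !act_s_monomial_weight0 // addrC.
Qed.

Lemma invariant_generator f : f \in gens_seq C d -> W_invariant zeta f.
Proof.
have mono a b : W_invariant zeta (x ^+ a * y ^+ a * X ^+ b * Y ^+ b).
  by apply/(W_invariantP z0); split; apply: act_s_monomial_weight0; exists 0, 0; lia.
rewrite mem_cat !inE => /orP[/or4P[/eqP ->|/eqP ->|/eqP ->|/orP[/eqP ->|/eqP ->]]|].
- by have := mono 1 0; rewrite !expr0 !mulr1.
- have -> : inv_r C d = orbit_sum d 0 0 0.
    by rewrite /inv_r /orbit_sum !expr0 !mulr1 mul1r.
  by apply: orbit_sum_invariant; exists 0, 1; lia.
- by have := mono 0 1; rewrite !expr0 !mul1r.
- have -> : inv_R C d = orbit_sum 0 0 d 0.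
    by rewrite /inv_R /orbit_sum !expr0 !mulr1 !mul1r.
  by apply: orbit_sum_invariant; exists 1, 0; lia.
- have -> : inv_eu C = orbit_sum 1 0 1 0.
    by rewrite /inv_eu /orbit_sum !expr0 !expr1 !mulr1 !mul1r.
  by apply: orbit_sum_invariant; exists 0, 0; lia.
case/mapP => k; rewrite mem_index_iota => /andP[k0 hk] ->.
have -> : inv_a C d k = orbit_sum (d - k) 0 0 k.
  by rewrite /inv_a /orbit_sum !expr0 !mulr1 !mul1r.
by apply: orbit_sum_invariant; exists 0, 1; lia.
Qed.

Lemma invariantP f : W_invariant zeta f <-> generated f.
Proof.
split; first exact: generated_of_invariant.
case=> p -> w hw; rewrite /act comp_mpolyA; congr (_ \mPo _).
apply: eq_from_tnth => i; rewrite tnth_mktuple -/(act w _).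
apply: invariant_generator hw; rewrite tnth_mktuple mem_nth //.
by rewrite size_gens_seq.
Qed.

End Generation.

(** * Minimality *)

Lemma mpoly_alg_ind (A : nzRingType) n (P : {mpoly A[n]} -> Prop) :
  (forall c, P c%:MP) -> (forall i, P 'X_i) ->
  (forall f g, P f -> P g -> P (f + g)) -> (forall f g, P f -> P g -> P (f * g)) ->
  forall f, P f.
Proof.
move=> PC PX PD PM; elim/mpolyind => [|c m p _ _ hp]; first by rewrite -mpolyC0.
apply: PD hp; rewrite -mul_mpolyC; apply/PM; first exact: PC.
rewrite mpolyXE_id; apply: (big_ind P) => [||i _]; [by rewrite -mpolyC1|exact: PM|].
move: (m i) => j; elim: j => [|j IH]; first by rewrite expr0 -mpolyC1.
by rewrite exprS; apply: PM.
Qed.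

Lemma mderiv_var (A : nzRingType) n (i k : 'I_n) :
  ('X_k : {mpoly A[n]})^`M(i) = (k == i)%:R%:MP.
Proof.
rewrite mderivX mnm1E; case: eqVneq => [->|_]; last by rewrite scale0r mpolyC0.
have -> : (U_(i) - U_(i) = 0)%MM by apply/mnmP => j; rewrite mnmBE subnn mnm0E.
by rewrite mpolyX0 scale1r mpolyC1.
Qed.

(** The chain rule, which turns a composite substitution into a product of Jacobian matrices. *)
Lemma mderiv_comp (A : comNzRingType) k n (t : k.-tuple {mpoly A[n]}) j p :
  (p \mPo t)^`M(j) = \sum_(l < k) (p^`M(l) \mPo t) * (tnth t l)^`M(j).
Proof.
elim/mpoly_alg_ind: p => [c|i|f g hf hg|f g hf hg].
- by rewrite comp_mpolyC mderivC big1 // => l _; rewrite mderivC comp_mpoly0 mul0r.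
- rewrite comp_mpolyXU -tnth_nth (bigD1 i) //= big1 ?addr0 => [|l nl].
    by rewrite mderiv_var eqxx comp_mpolyC mpolyC1 mul1r.
  by rewrite mderiv_var eq_sym (negPf nl) comp_mpolyC mpolyC0 mul0r.
- rewrite comp_mpolyD mderivD hf hg -big_split /=; apply: eq_bigr => l _.
  by rewrite mderivD comp_mpolyD mulrDl.
rewrite rmorphM /= mderivM hf hg mulr_suml mulr_sumr -big_split /=.
apply: eq_bigr => l _; rewrite mderivM comp_mpolyD !rmorphM /=; ring.
Qed.

(** * Constant, linear and quadratic parts at the origin *)

Section LowOrder.

Variables (C : numFieldType) (n : nat).
Implicit Types f g : {mpoly C[n]}.

(** [order1] and [order2] are membership in the irrelevant ideal m and in its square, tested by
    derivatives at the origin. *)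
Definition order1 f := f@_0%MM = 0.
Definition order2 f := f@_0%MM = 0 /\ forall j, f^`M(j)@_0%MM = 0.

Lemma mcoeff0M f g : (f * g)@_0%MM = f@_0%MM * g@_0%MM.
Proof. exact: rmorphM. Qed.

Lemma order1_var i : order1 'X_i.
Proof. by rewrite /order1 mcoeffX mnm1_eq0. Qed.

Lemma order1M f g : order1 f -> order1 (f * g).
Proof. by rewrite /order1 mcoeff0M => ->; rewrite mul0r. Qed.

Lemma order1B f g : order1 f -> order1 g -> order1 (f - g).
Proof. by rewrite /order1 mcoeffB => -> ->; rewrite subrr. Qed.

Lemma order1X f k : (0 < k)%N -> order1 f -> order1 (f ^+ k).
Proof. by case: k => // k _; rewrite exprS; apply: order1M. Qed.

Lemma order2_mul f g : order1 f -> order1 g -> order2 (f * g).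
Proof.
move=> hf hg; split=> [|j]; first by rewrite mcoeff0M hf mul0r.
by rewrite mderivM mcoeffD !mcoeff0M hf hg mul0r mulr0 addr0.
Qed.

Lemma order2M g f : order2 f -> order2 (g * f).
Proof.
move=> [hf hf']; split=> [|j]; first by rewrite mcoeff0M hf mulr0.
by rewrite mderivM mcoeffD !mcoeff0M hf hf' !mulr0 addr0.
Qed.

Lemma order2D f g : order2 f -> order2 g -> order2 (f + g).
Proof.
move=> [hf hf'] [hg hg']; split=> [|j]; first by rewrite mcoeffD hf hg addr0.
by rewrite mderivD mcoeffD hf' hg' addr0.
Qed.

Lemma order2B f g : order2 f -> order2 g -> order2 (f - g).
Proof. by move=> hf hg; rewrite -mulN1r; apply/order2D/order2M. Qed.

Lemma order20 : order2 0.
Proof. by split=> [|j]; rewrite ?mderiv0 mcoeff0. Qed.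

(** The coefficient of ['X_i * 'X_j], doubled when [i = j]. *)
Definition coef2 (i j : 'I_n) f := f^`M(i)^`M(j)@_0%MM.

Lemma coef2D i j f g : coef2 i j (f + g) = coef2 i j f + coef2 i j g.
Proof. by rewrite /coef2 !mderivD mcoeffD. Qed.

Lemma coef2B i j f g : coef2 i j (f - g) = coef2 i j f - coef2 i j g.
Proof. by rewrite /coef2 !mderivB mcoeffB. Qed.

Lemma coef20 i j : coef2 i j 0 = 0.
Proof. by rewrite /coef2 !mderiv0 mcoeff0. Qed.

Lemma coef2_sum i j (J : Type) (s : seq J) (F : J -> {mpoly C[n]}) :
  coef2 i j (\sum_(k <- s) F k) = \sum_(k <- s) coef2 i j (F k).
Proof.
elim: s => [|k s IH]; first by rewrite !big_nil coef20.
by rewrite !big_cons coef2D IH.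
Qed.

(** On an ideal inside m^2, [coef2] thus kills multiples by elements of m and gives a linear form on
    the ideal modulo m times it. *)
Lemma coef2M i j g f : order2 f -> coef2 i j (g * f) = g@_0%MM * coef2 i j f.
Proof.
move=> [hf hf']; rewrite /coef2 !(mderivM, mderivD) !mcoeffD !mcoeff0M hf !hf'.
by rewrite !mulr0 !add0r.
Qed.

Lemma coef2_flat i j g f : order1 g -> g^`M(i) = 0 -> g^`M(j) = 0 ->
  coef2 i j (g * f) = 0.
Proof.
move=> hg hi hj; rewrite /coef2 mderivM hi mul0r add0r mderivM hj mul0r add0r.
by rewrite mcoeff0M hg mul0r.
Qed.

Lemma coef2_var i j k l :
  coef2 i j ('X_k * 'X_l) = (k == i)%:R * (l == j)%:R + (k == j)%:R * (l == i)%:R.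
Proof.
rewrite /coef2 mderivM !mderiv_var mderivD !mderivM !mderivC !mderiv_var mul0r mulr0.
by rewrite add0r addr0 mcoeffD -!mpolyCM !mcoeffC eqxx !mulr1.
Qed.

End LowOrder.

Section RelationIndex.

Variable d : nat.

(** With eu numbered 0 and a_i numbered [i], a pair lists the two factors of the product that opens
    its relation; [(0, i)] stands for Z_i. *)
Definition rel_index : seq (nat * nat) :=
  [seq (0, i) | i <- index_iota 1 d]
  ++ [seq (i, j) | i <- index_iota 1 d, j <- index_iota i d].

Lemma mem_rel_index a b : ((a, b) \in rel_index) = (a <= b)%N && (0 < b < d)%N.
Proof.
rewrite mem_cat; apply/orP/idP => [[]|].
- by case/mapP => i; rewrite mem_index_iota => hi [-> ->].
- by case/allpairsPdep => i [j []]; rewrite !mem_index_iota => hi hj [-> ->]; lia.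
case/andP=> hab hb; case: (posnP a) => [->|a0]; [left|right].
  by apply/mapP; exists b; rewrite ?mem_index_iota.
by apply/allpairsPdep; exists a, b; rewrite !mem_index_iota; split=> //; lia.
Qed.

Lemma uniq_rel_index : uniq rel_index.
Proof.
rewrite cat_uniq map_inj_uniq ?iota_uniq; last by move=> i j [].
rewrite allpairs_uniq_dep ?iota_uniq //=; last 2 first.
- by move=> i _; apply: iota_uniq.
- by move=> [i j] [i' j'] _ _ [-> ->].
rewrite andbT; apply/hasPn => -[a b] /allpairsPdep[i [j [hi _ [-> _]]]].
by apply/negP => /mapP[k _ [i0 _]]; move: hi; rewrite mem_index_iota i0.
Qed.

Lemma size_rel_index : (0 < d)%N ->
  size rel_index = ((d + 2) * (d - 1) %/ 2)%N.
Proof.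
move=> hd; rewrite size_cat size_map size_iota size_allpairs_dep sumnE big_map.
under eq_bigr do rewrite size_iota.
rewrite -/(index_iota 1 d) big_nat_rev /=.
have -> : (\sum_(1 <= i < d) (d - (1 + d - i.+1)) = 'C(d, 2))%N.
  rewrite -bin2_sum [RHS]big_ltn // add0n; apply: eq_big_nat => i hi; lia.
rewrite bin2 -divn2 -subn1 -(divnMDl _ _ (isT : 0 < 2)%N); congr (_ %/ _)%N.
by lia.
Qed.

End RelationIndex.

Section MinimalPresentation.

Variables (C : numClosedFieldType) (d : nat).
Hypothesis hd : (0 < d)%N.

Local Notation q := (var_q C d).
Local Notation r := (var_r C d).
Local Notation Q := (var_Q C d).
Local Notation R := (var_R C d).
Local Notation e := (var_eu C d).
Local Notation T := (var_eu_pow C d).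

Definition rel_at (k : nat * nat) : {mpoly C[d.+4]} :=
  if k.1 == 0 then rel_Z C d k.2 else rel_ZZ C d k.1 k.2.

Lemma relationsE : relations C d = map rel_at (rel_index d).
Proof.
rewrite /relations /rel_index map_cat; congr (_ ++ _); first by rewrite -map_comp.
rewrite map_allpairs; apply/eq_in_allpairs_dep => i hi j _.
by move: hi; rewrite mem_index_iota /rel_at; case: i.
Qed.

Lemma order1_a i : order1 (var_a C d i).
Proof. by rewrite /var_a; case: ifP => _; [|case: ifP => _]; apply: order1_var. Qed.

Lemma order1_T k : (0 < k)%N -> order1 (T k).
Proof.
elim/nat_ind2: k => [||k _ IH] // _; first exact: order1_var.
rewrite /var_eu_pow eu_powSS; apply: order1B; apply: order1M; first exact: order1_var.
by apply: order1M; apply: order1_var.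
Qed.

Lemma order2_T k : (1 < k)%N -> order2 (T k).
Proof.
case: k => [|[|k]] // _; rewrite /var_eu_pow eu_powSS; apply: order2B.
  by apply: order2_mul; [apply: order1_var|apply: order1_T].
by rewrite mulrC; apply/order2M/order2_mul; apply: order1_var.
Qed.

(** The danger is a constant or linear eu^(k). In Z_(i,j) each such factor comes with positive
    powers of q or Q, except eu^(d) when [i + j = d], and then [d] is at least 2. *)
Lemma order2_all_relations f : f \in all_relations C d -> order2 f.
Proof.
have ve : order1 e := order1_var _ _; have vq : order1 q := order1_var _ _.
have vr : order1 r := order1_var _ _; have vQ : order1 Q := order1_var _ _.
have vR : order1 R := order1_var _ _.
rewrite /all_relations; case: eqVneq => [d1|_].
  rewrite inE => /eqP ->; apply: order2B.
    by apply: order2_mul => //; apply: order1B => //; apply: order1M.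
  apply: order2D; apply: order2_mul => //; apply: order1B;
    by rewrite -?mul_mpolyC ?[_%:MP * _]mulrC; apply: order1M.
case/(relationsP hd) => [[i hi ->]|[i [j [i0 hij ->]]]].
  by apply: order2B; [|apply: order2D]; apply: order2_mul => //; apply: order1_a.
apply: order2B; first by apply: order2_mul; apply: order1_a.
apply: order2D.
  by rewrite mulrC; apply/order2M/order2_mul; apply: order1X => //; lia.
case: ltnP => h.
  apply: order2B; first by apply: order2_mul => //; apply: order1_a.
  by apply: order2_mul; [apply: order1X => //; lia|apply: order1_T; lia].
case: eqVneq => h'.
  by apply: order2B; [apply: order2_mul|apply: order2_T; lia].
apply: order2B; first by apply: order2_mul => //; apply: order1_a.
by apply: order2_mul; [apply: order1X => //; lia|apply: order1_T; lia].
Qed.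

Variable zeta : C.
Hypothesis hz : d.-primitive_root zeta.

Lemma order2_kernel p : p \mPo gens C d = 0 -> order2 p.
Proof.
move/(kernelP hd hz p); move: p; apply: ideal_gen_ind; last exact: order2_all_relations.
- exact: order20.
- exact: order2D.
- exact: order2M.
Qed.

(* As relations have no linear term, the substitution of the generators by
   polynomials in s and back has Jacobian 1 at the origin. *)
Lemma minimal_generators n (s : n.-tuple {mpoly C[2 + 2]}) :
  (forall f, W_invariant zeta f <-> subalgebra_gen s f) -> (d + 4 <= n)%N.
Proof.
move=> hs.
have /fin_all_exists [p hp] : forall i : 'I_d.+4, exists p, tnth (gens C d) i = p \mPo s.
  by move=> i; apply/hs/(invariantP hd hz); apply: subalgebra_gen_tnth.
have /fin_all_exists [t ht] : forall l : 'I_n, exists t, tnth s l = t \mPo gens C d.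
  by move=> l; apply/(invariantP hd hz)/hs; apply: subalgebra_gen_tnth.
pose tt := [tuple t l | l < n].
have ker i : order2 ('X_i - (p i \mPo tt)).
  apply: order2_kernel; rewrite comp_mpolyB comp_mpolyXU -tnth_nth comp_mpolyA hp.
  apply/eqP; rewrite subr_eq0; apply/eqP; congr (_ \mPo _).
  by apply: eq_from_tnth => l; rewrite !tnth_mktuple ht.
pose M := \matrix_(i < d.+4, l < n) ((p i)^`M(l) \mPo tt)@_0%MM.
pose N := \matrix_(l < n, j < d.+4) (t l)^`M(j)@_0%MM.
have : M *m N = 1%:M.
  apply/matrixP => i j; rewrite !mxE; have [_ /(_ j)] := ker i.
  rewrite mderivB mderiv_var mderiv_comp mcoeffB mcoeffC eqxx mulr1 => /eqP.
  rewrite subr_eq0 => /eqP ->; rewrite raddf_sum /=; apply: eq_bigr => l _.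
  by rewrite !mxE mcoeff0M tnth_mktuple.
by move/mulmx1_min; rewrite addn4.
Qed.

Definition index_var a : 'I_d.+4 := inord (4 + a).

Lemma index_var_inj a b : (a < d)%N -> (b < d)%N ->
  (index_var a == index_var b) = (a == b).
Proof. by move=> ha hb; rewrite -val_eqE /= !inordK ?eqn_add2l //; lia. Qed.

Lemma mderiv_low a k : (a < d)%N -> (k < 4)%N ->
  ('X_(inord k) : {mpoly C[d.+4]})^`M(index_var a) = 0.
Proof.
move=> ha hk; rewrite mderiv_var -val_eqE /= !inordK; try lia.
by rewrite ltn_eqF ?mpolyC0 //; lia.
Qed.

Lemma mderiv_T b k : (0 < b < d)%N -> (T k)^`M(index_var b) = 0.
Proof.
move=> hb; elim/nat_ind2: k => [||k IH1 IH2].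
- by rewrite /var_eu_pow /= -mpolyC_nat mderivC.
- rewrite /var_eu_pow /= mderiv_var -[inord 4]/(index_var 0) index_var_inj; try lia.
  by rewrite ltn_eqF ?mpolyC0 //; lia.
have De : e^`M(index_var b) = 0.
  rewrite -[e]/('X_(index_var 0)) mderiv_var index_var_inj; try lia.
  by rewrite ltn_eqF ?mpolyC0 //; lia.
rewrite /var_eu_pow eu_powSS mderivB !mderivM IH1 IH2 De !mderiv_low; try lia.
by rewrite !(mul0r, mulr0, addr0, subr0).
Qed.

Lemma var_aE i : (0 < i < d)%N -> var_a C d i = 'X_(index_var i).
Proof. by move=> hi; rewrite /var_a gtn_eqF ?ltn_eqF //; lia. Qed.

(** Apart from its opening product, every term of a relation has a factor q, r, Q or R, or is [T d],
    which does not involve the variable numbered [k.2 > 0]. The value on the diagonal is 1, or 2 for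
    a square. *)
Lemma coef2_rel_at k k' : k \in rel_index d -> k' \in rel_index d ->
  (coef2 (index_var k.1) (index_var k.2) (rel_at k') != 0) = (k == k').
Proof.
case: k k' => [a b] [i j]; rewrite !mem_rel_index xpair_eqE /= => hab hij.
set D := coef2 _ _.
have ord (n : 'I_d.+4) : order1 ('X_n : {mpoly C[d.+4]}) by apply: order1_var.
have Dlow n f : (n < 4)%N -> D ('X_(inord n) * f) = 0.
  by move=> hn; apply: coef2_flat; [exact: ord|apply: mderiv_low; lia..].
have DlowX n l f g : (n < 4)%N -> (0 < l)%N -> D ('X_(inord n) ^+ l * f * g) = 0.
  by case: l => // l hn _; rewrite exprS -!mulrA Dlow.
have Dq f : D (q * f) = 0 by apply: Dlow.
have Dr f : D (r * f) = 0 by apply: Dlow.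
have DQ f : D (Q * f) = 0 by apply: Dlow.
have DR f : D (R * f) = 0 by apply: Dlow.
have DT l : D (T l) = 0.
  by rewrite /D /coef2 mderiv_comm mderiv_T ?mderiv0 ?mcoeff0 //; lia.
have DV m n : (m < d)%N -> (n < d)%N -> D ('X_(index_var m) * 'X_(index_var n))
    = ((m == a) * (n == b) + (m == b) * (n == a))%:R.
  by move=> hm hn; rewrite /D coef2_var !index_var_inj ?natrD ?natrM //; lia.
suff -> : D (rel_at (i, j)) = ((i == a) * (j == b) + (i == b) * (j == a))%:R.
  by rewrite pnatr_eq0; lia.
rewrite /rel_at /=; case: eqVneq => [i0|i0].
  rewrite /rel_Z var_aE; last lia.
  rewrite -[var_eu C d]/'X_(index_var 0) /D coef2B coef2D -/D Dq DQ addr0 subr0.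
  by rewrite DV ?i0 //; lia.
rewrite /rel_ZZ (@var_aE i) ?(@var_aE j); try lia.
rewrite /D coef2B coef2D -/D DV; try lia.
rewrite [X in _ - (X + _)]DlowX; try lia.
apply/eqP; rewrite add0r subr_eq addrC -subr_eq subrr eq_sym; apply/eqP.
case: ltnP => h.
  by rewrite /D coef2B -/D Dr -[_ * T _]mulr1 DlowX ?subr0 //; lia.
case: eqVneq => h'; first by rewrite /D coef2B -/D Dr DT subr0.
by rewrite /D coef2B -/D DR -[_ * T _]mulr1 DlowX ?subr0 //; lia.
Qed.

(* On a combination of relations, coef2 depends only on the constant terms of the
   coefficients, so the diagonal matrix of its values at the relations has rank at
   most size s. *)
Lemma minimal_relations (s : seq {mpoly C[d.+4]}) :
  (forall p, p \mPo gens C d = 0 <-> ideal_gen s p) ->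
  ((d + 2) * (d - 1) %/ 2 <= size s)%N.
Proof.
move=> hs; case: (eqVneq d 1%N) => [d1|d1].
  by have -> : ((d + 2) * (d - 1) %/ 2 = 0)%N by rewrite d1.
rewrite -size_rel_index //.
set N := size (rel_index d); pose K (i : 'I_N) := nth (0, 0) (rel_index d) i.
have KI i : K i \in rel_index d by apply: mem_nth.
have s2 k : order2 s`_k.
  case: (ltnP k (size s)) => hk; last by rewrite nth_default //; apply: order20.
  by apply/order2_kernel/hs/ideal_gen_mem/mem_nth.
have /fin_all_exists [c hc] : forall i : 'I_N, exists c : 'I_(size s) -> {mpoly C[d.+4]},
    rel_at (K i) = \sum_k c k * s`_k.
  move=> i; apply/hs/(ev_all_relations hd); rewrite /all_relations (negPf d1).
  by rewrite relationsE map_f.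
pose D (j : 'I_N) := @coef2 C d.+4 (index_var (K j).1) (index_var (K j).2).
pose A := \matrix_(i < N, k < size s) (c i k)@_0%MM.
(* The division normalises the diagonal values 1 and 2, so that the product is the identity. *)
pose B := \matrix_(k < size s, j < N) (D j s`_k / D j (rel_at (K j))).
suff /mulmx1_min : A *m B = 1%:M by [].
apply/matrixP => i j; rewrite !mxE.
transitivity (D j (rel_at (K i)) / D j (rel_at (K j))).
  rewrite hc /D coef2_sum mulr_suml; apply: eq_bigr => k _.
  by rewrite !mxE coef2M // mulrA.
have := coef2_rel_at (KI j) (KI i); have := coef2_rel_at (KI j) (KI j).
have KE : (K j == K i) = (j == i) by rewrite /K nth_uniq ?uniq_rel_index.
rewrite -/(D j) eqxx KE [j == i]eq_sym => Dj.
case: (eqVneq i j) => [-> _|_]; first by rewrite divff.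
by move=> /negbFE /eqP ->; rewrite mul0r.
Qed.

End MinimalPresentation.

(** * Decomposition over P_bullet *)

Section DirectSum.

Variables (C : numClosedFieldType) (d : nat) (zeta : C).
Hypotheses (hd : (0 < d)%N) (hz : d.-primitive_root zeta).

Local Notation F := (inv_fund C d).

(* Below e sets X = Y = 0 or x = y = 0, which maps every generator into
   C[q, r, Q, R]. *)
Lemma generated_fund_of_proj (e : (2 + 2).-tuple {mpoly C[2 + 2]}) f :
  (forall g, g \in gens_seq C d -> subalgebra_gen F (g \mPo e)) ->
  f \mPo e = f -> W_invariant zeta f -> subalgebra_gen F f.
Proof.
move=> he fe /(invariantP hd hz) [p fp]; rewrite -fe fp comp_mpolyA.
apply: subalgebra_gen_comp => i; rewrite tnth_mktuple; apply: he.
by rewrite tnth_mktuple mem_nth // size_gens_seq.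
Qed.

Lemma fund_mem f : f \in [:: inv_q C; inv_r C d; inv_Q C; inv_R C d] ->
  subalgebra_gen F f.
Proof. exact: subalgebra_gen_mem. Qed.

Definition proj_xy : (2 + 2).-tuple {mpoly C[2 + 2]} := [tuple vx C; vy C; 0; 0].
Definition proj_XY : (2 + 2).-tuple {mpoly C[2 + 2]} := [tuple 0; 0; vX C; vY C].

Lemma fund_of_proj_xy g : g \in gens_seq C d -> subalgebra_gen F (g \mPo proj_xy).
Proof.
have ex : vx C \mPo proj_xy = vx C by rewrite comp_mpolyXU.
have ey : vy C \mPo proj_xy = vy C by rewrite comp_mpolyXU.
have eX : vX C \mPo proj_xy = 0 by rewrite comp_mpolyXU.
have eY : vY C \mPo proj_xy = 0 by rewrite comp_mpolyXU.
have h0 : subalgebra_gen F 0 by apply: subalgebra_gen0.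
rewrite mem_cat !inE => /orP[/or4P[/eqP ->|/eqP ->|/eqP ->|/orP[/eqP ->|/eqP ->]]|].
- by rewrite rmorphM /= ex ey; apply: fund_mem; rewrite !inE eqxx.
- rewrite rmorphD !rmorphXn /= ex ey; apply: fund_mem; rewrite !inE eqxx orbT //.
- by rewrite rmorphM /= eX mul0r.
- by rewrite rmorphD !rmorphXn /= eX eY expr0n gtn_eqF // addr0.
- by rewrite rmorphD !rmorphM /= eX eY !mulr0 addr0.
case/mapP => k; rewrite mem_index_iota => /andP[k0 hk] ->.
rewrite rmorphD !rmorphM !rmorphXn /= eX eY expr0n gtn_eqF // !mulr0 addr0.
exact: h0.
Qed.

Lemma fund_of_proj_XY g : g \in gens_seq C d -> subalgebra_gen F (g \mPo proj_XY).
Proof.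
have ex : vx C \mPo proj_XY = 0 by rewrite comp_mpolyXU.
have ey : vy C \mPo proj_XY = 0 by rewrite comp_mpolyXU.
have eX : vX C \mPo proj_XY = vX C by rewrite comp_mpolyXU.
have eY : vY C \mPo proj_XY = vY C by rewrite comp_mpolyXU.
have h0 : subalgebra_gen F 0 by apply: subalgebra_gen0.
rewrite mem_cat !inE => /orP[/or4P[/eqP ->|/eqP ->|/eqP ->|/orP[/eqP ->|/eqP ->]]|].
- by rewrite rmorphM /= ex mul0r.
- by rewrite rmorphD !rmorphXn /= ex ey expr0n gtn_eqF // addr0.
- by rewrite rmorphM /= eX eY; apply: fund_mem; rewrite !inE eqxx !orbT.
- by rewrite rmorphD !rmorphXn /= eX eY; apply: fund_mem; rewrite !inE eqxx !orbT.
- by rewrite rmorphD !rmorphM /= ex ey !mul0r addr0.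
case/mapP => k; rewrite mem_index_iota => /andP[k0 hk] ->.
rewrite rmorphD !rmorphM !rmorphXn /= ex ey expr0n subn_eq0 leqNgt hk !mul0r addr0.
exact: h0.
Qed.

Lemma fund_of_xy f : subalgebra_gen [tuple vx C; vy C] f -> W_invariant zeta f ->
  subalgebra_gen F f.
Proof.
case=> p fp; apply: (generated_fund_of_proj fund_of_proj_xy).
rewrite fp comp_mpolyA; congr (_ \mPo _); apply: eq_from_tnth => i.
rewrite tnth_mktuple !(tnth_nth 0).
by case: i => [[|[|i]] hi] //=; rewrite comp_mpolyXU.
Qed.

Lemma fund_of_XY f : subalgebra_gen [tuple vX C; vY C] f -> W_invariant zeta f ->
  subalgebra_gen F f.
Proof.
case=> p fp; apply: (generated_fund_of_proj fund_of_proj_XY).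
rewrite fp comp_mpolyA; congr (_ \mPo _); apply: eq_from_tnth => i.
rewrite tnth_mktuple !(tnth_nth 0).
by case: i => [[|[|i]] hi] //=; rewrite comp_mpolyXU.
Qed.

Lemma W_invariant_fund f : subalgebra_gen F f -> W_invariant zeta f.
Proof.
case=> p ->; apply/(invariantP hd hz); apply: subalgebra_gen_comp => i.
apply/(invariantP hd hz)/(invariant_generator hd hz).
have : tnth F i \in F by apply: mem_tnth.
move: (tnth F i) => g; rewrite mem_cat /= !inE.
by case/or4P => ->; rewrite ?orbT.
Qed.

(** From right to left, each monomial of [p] splits into a part in Q, R and a part in q, r that
    carries the coefficient. *)
Lemma P_bulletP f : P_bullet zeta f <-> subalgebra_gen F f.
Proof.
split=> [[n [g [h [hg [hh ->]]]]]|[p ->]].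
  apply: subalgebra_gen_sum => i _; apply: subalgebra_genM.
    by have [] := hg i; apply: fund_of_XY.
  by have [] := hh i; apply: fund_of_xy.
pose m (i : 'I_(size (msupp p))) := nth 0%MM (msupp p) i.
pose mi i k := m i (inord k : 'I_4).
exists (size (msupp p)), (fun i => inv_Q C ^+ mi i 2 * inv_R C d ^+ mi i 3),
  (fun i => p@_(m i) *: (inv_q C ^+ mi i 0 * inv_r C d ^+ mi i 1)).
have inv g : g \in [:: inv_q C; inv_r C d; inv_Q C; inv_R C d] ->
    forall k, W_invariant zeta (g ^+ k).
  by move=> hg k; apply/W_invariant_fund/subalgebra_genX/fund_mem.
have WM u v : W_invariant zeta u -> W_invariant zeta v -> W_invariant zeta (u * v).
  by move=> hu hv w hw; rewrite actM hu // hv.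
have WZ c u : W_invariant zeta u -> W_invariant zeta (c *: u).
  by move=> hu w hw; rewrite actZ hu.
split; [move=> i; split|split; [move=> i; split|]].
- apply: subalgebra_genM; apply: subalgebra_genX.
    by apply: subalgebra_genM; apply: subalgebra_gen_mem; rewrite !inE eqxx ?orbT.
  apply: subalgebra_genD; apply/subalgebra_genX/subalgebra_gen_mem;
    by rewrite !inE eqxx ?orbT.
- by apply: WM; apply: inv; rewrite !inE eqxx ?orbT.
- apply: subalgebra_genZ; apply: subalgebra_genM; apply: subalgebra_genX.
    by apply: subalgebra_genM; apply: subalgebra_gen_mem; rewrite !inE eqxx ?orbT.
  apply: subalgebra_genD; apply/subalgebra_genX/subalgebra_gen_mem;
    by rewrite !inE eqxx ?orbT.
- by apply: WZ; apply: WM; apply: inv; rewrite !inE eqxx ?orbT.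
rewrite comp_mpolyE (big_nth 0%MM) big_mkord; apply: eq_bigr => i _.
rewrite -scalerAr; congr (_ *: _); rewrite !big_ord_recl big_ord0 mulr1 !(tnth_nth 0) /=.
rewrite [RHS]mulrC !mulrA /mi /m; do !congr (_ * _); congr (_ ^+ _);
  congr (fun_of_multinom _ _); apply: val_inj;
  by rewrite /= inordK.
Qed.

Lemma size_module_basis : size (module_basis C d) = (d.+1 + d.-1)%N.
Proof. by rewrite size_cat !size_map !size_iota subn1. Qed.

(** The powers of eu fill positions 0 to [d], so a_i sits at position [d + i]. *)
Lemma sum_module_basis (G : nat -> {mpoly C[2 + 2]}) :
  \sum_(k < size (module_basis C d)) G k * (module_basis C d)`_k
  = \sum_(0 <= k < d.+1) G k * inv_eu C ^+ k
    + \sum_(1 <= i < d) G (d + i)%N * inv_a C d i.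
Proof.
rewrite -(big_mkord xpredT (fun k => G k * (module_basis C d)`_k)) size_module_basis.
rewrite (@big_cat_nat _ _ _ d.+1) //= ?leq_addr //; congr (_ + _).
  apply: eq_big_nat => k /andP[_ hk]; rewrite nth_cat size_map size_iota hk.
  by rewrite (nth_map 0%N) ?size_iota // nth_iota.
rewrite -[X in \sum_(X <= _ < _) _ = _]add1n big_addn.
have -> : (d.+1 + d.-1 - d = d)%N by lia.
apply: eq_big_nat => k /andP[k0 hk]; rewrite addnC nth_cat size_map size_iota.
have -> : (d + k < d.+1 - 0)%N = false by lia.
rewrite (nth_map 0%N) ?size_iota; last lia.
rewrite nth_iota; last lia.
by congr (_ * inv_a _ _ _); lia.
Qed.

Lemma module_basis_invariant k : W_invariant zeta (module_basis C d)`_k.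
Proof.
case: (ltnP k (size (module_basis C d))) => hk; last first.
  by rewrite nth_default // => w _; rewrite /act comp_mpoly0.
suff inv (g : {mpoly C[2 + 2]}) : g \in module_basis C d -> W_invariant zeta g.
  exact/inv/mem_nth.
rewrite mem_cat; case/orP; case/(@mapP _ {mpoly C[2 + 2]}) => i;
  rewrite mem_index_iota => hi ->.
  move=> w hw; rewrite actX (invariant_generator hd hz) //.
  by rewrite mem_cat !inE eqxx !orbT.
apply: (invariant_generator hd hz); rewrite mem_cat; apply/orP; right.
by apply: map_f; rewrite mem_index_iota.
Qed.

(** Reducibility of every polynomial in the generators gives the sum, and independence of normal
    forms gives its directness. *)
Lemma module_decomposition :
  internal_direct_sum (W_invariant zeta)
    (fun (k : 'I_(size (module_basis C d))) f =>
       exists2 c, P_bullet zeta c & f = c * (module_basis C d)`_k).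
Proof.
split=> [v|u hu]; first split=> [/(invariantP hd hz) [p ->]|[u [hu ->]] w hw].
- have [c [a hI]] := reducible_mod_all_relations hd p.
  pose G k := (if (k < d.+1)%N then c k else a (k - d)%N) \mPo F.
  exists (fun k => G k * (module_basis C d)`_k); split.
    by move=> k; exists (G k) => //; apply/P_bulletP; eexists.
  rewrite sum_module_basis; have := ev_ideal hd hI.
  rewrite comp_mpolyB ev_normal_form // => /eqP; rewrite subr_eq0 => /eqP ->.
  congr (_ + _); apply: eq_big_nat => k /andP[k0 hk]; rewrite /G ?hk //.
  by rewrite ltnNge (_ : d < d + k)%N ?addKn //; lia.
- rewrite act_sum; apply: eq_bigr => k _; have [c /P_bulletP/W_invariant_fund hc ->] := hu k.
  by rewrite actM hc // module_basis_invariant.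
have /fin_all_exists [c hc] : forall k, exists c : {mpoly C[4]},
    u k = (c \mPo F) * (module_basis C d)`_k.
  by move=> k; have [c /P_bulletP [p ->] ->] := hu k; exists p.
(* Extension by 0 from ordinals to naturals, the index type of normal forms. *)
pose cc k := if insub k is Some i then c i else 0.
have ucc k : u k = (cc k \mPo F) * (module_basis C d)`_k by rewrite /cc valK hc.
rewrite (eq_bigr _ (fun k _ => ucc k)) (sum_module_basis (fun k => cc k \mPo F)).
case/(normal_form_independence hd hz (a := fun i => cc (d + i)%N)) => h1 h2 k.
suff e : cc k = 0 by rewrite ucc e comp_mpoly0 mul0r.
have := ltn_ord k; rewrite [X in (_ < X)%N]size_module_basis => hk.
case: (leqP k d) => kd; first exact: h1.
by rewrite -(subnKC (ltnW kd)); apply: h2; lia.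
Qed.

End DirectSum.

(* For d = 1 the list of relations is empty whereas the five generators satisfy
   eu (r R - eu) = Q (r^2 - 2 q) + q (R^2 - 2 Q), hence the guard 1 < d on the
   description of the ideal of relations; everything else is for d > 0. *)
Theorem theorem2p2 (R : realType) (d : nat) (zeta : R[i])
    (hd : (0 < d)%N) (hzeta : d.-primitive_root zeta) :
  (forall f : {mpoly R[i][2 + 2]},
     W_invariant zeta f <-> subalgebra_gen (gens R[i] d) f)
  /\ ((1 < d)%N -> forall p : {mpoly R[i][d.+4]},
        p \mPo (gens R[i] d) = 0 <-> ideal_gen (relations R[i] d) p)
  /\ size (gens_seq R[i] d) = (d + 4)%N
  /\ size (relations R[i] d) = ((d + 2) * (d - 1) %/ 2)%N
  /\ (forall (n : nat) (s : n.-tuple {mpoly R[i][2 + 2]}),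
        (forall f, W_invariant zeta f <-> subalgebra_gen s f) ->
        (d + 4 <= n)%N)
  /\ (forall s : seq {mpoly R[i][d.+4]},
        (forall p, p \mPo (gens R[i] d) = 0 <-> ideal_gen s p) ->
        ((d + 2) * (d - 1) %/ 2 <= size s)%N)
  /\ (forall f : {mpoly R[i][2 + 2]},
        P_bullet zeta f <->
        subalgebra_gen
          [tuple inv_q R[i]; inv_r R[i] d; inv_Q R[i]; inv_R R[i] d] f)
  /\ internal_direct_sum (W_invariant zeta)
       (fun (k : 'I_(size (module_basis R[i] d))) f =>
          exists2 c, P_bullet zeta c & f = c * (module_basis R[i] d)`_k).
Proof.
split; first exact: (invariantP hd hzeta).
split.
  move=> d1 p; have := kernelP hd hzeta p.
  by rewrite /all_relations gtn_eqF.
split; first by rewrite size_gens_seq // addn4.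
split; first by rewrite relationsE size_map size_rel_index.
split; first exact: (minimal_generators hd hzeta).
split; first exact: (minimal_relations hd hzeta).
split; first exact: (P_bulletP hd hzeta).
exact: (module_decomposition hd hzeta).
Qed.
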